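(* Let $B$ be a body and let $P$ be a $G_{3C}$-structure on $B$, i.e. the structure given by two one-forms $\omega_1,\omega_2$ which are linearly independent at every point, and a volume form $\Omega$. Then $P$ is integrable if and only if $\omega_1$ and $\omega_2$ are closed.
   Context: A body is a $3$-dimensional smooth manifold which can be covered with one chart. $G_{3C}\subset GL(3,\mathbb{R})$ is the isotropy group of the covectors $e^2$, $e^3$ and the tensor $e^1\wedge e^2\wedge e^3$, where $(e^i)$ is the dual of the canonical basis of $\mathbb{R}^3$. The corresponding $G_{3C}$-structure $P$ is the set of linear frames $(v_1,v_2,v_3)$ at points of $B$ such that $\omega_1(v_2)=1$, $\omega_1(v_1)=\omega_1(v_3)=0$, $\omega_2(v_3)=1$, $\omega_2(v_1)=\omega_2(v_2)=0$ and $\Omega(v_1,v_2,v_3)=1$. A $G$-structure $P$ is integrable if around each point there are local coordinates $(x^1,x^2,x^3)$ whose coordinate frame is a section of $P$. *)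

(* Defs.v *)
From HB Require Import structures.
From mathcomp Require Import all_boot all_order all_algebra.
From mathcomp Require Import all_classical all_reals all_analysis.
From mathcomp Require Import ring.

Set Implicit Arguments.
Unset Strict Implicit.
Unset Printing Implicit Defensive.

Import Order.TTheory GRing.Theory Num.Theory.
Import numFieldNormedType.Exports.

Local Open Scope classical_set_scope.
Local Open Scope ring_scope.

Definition basis_vec (R : realType) (i : 'I_3) : 'rV[R]_3 := delta_mx 0 i.

(* Only used for open U, where values of f outside U are irrelevant. *)
Fixpoint Ck (R : realType) (W : normedModType R) (k : nat)
    (U : set 'rV[R]_3) (f : 'rV[R]_3 -> W) : Prop :=
  match k with
  | 0%N => forall x, U x -> {for x, continuous f}
  | k'.+1 => (forall x, U x -> differentiable f x) /\
             (forall i, Ck k' U (fun x => 'D_(basis_vec R i) f x))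
  end.

Definition smooth (R : realType) (W : normedModType R)
    (U : set 'rV[R]_3) (f : 'rV[R]_3 -> W) : Prop :=
  forall k, Ck k U f.

(* A homeomorphism x from the open set V onto an open subset of R^3. *)
Definition topological_chart (R : realType) (B : topologicalType)
    (V : set B) (x : B -> 'rV[R]_3) : Prop :=
  [/\ open V,
      {in V &, injective x},
      (forall p, V p -> {for p, continuous x}) &
      (forall V', open V' -> V' `<=` V -> open (x @` V'))].

(* The representative f o x^-1 : x(V) -> W of f in the chart (V, x),
   extended by 0 outside x(V). *)
Definition in_chart (R : realType) (B : topologicalType) (W : normedModType R)
    (V : set B) (x : B -> 'rV[R]_3) (f : B -> W) : 'rV[R]_3 -> W :=
  fun y => xget 0 [set f p | p in [set q | V q /\ x q = y]].

(* A manifold covered by one chart.  Its smooth structure is the maximal atlas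
   of the global chart, that is, the charts satisfying local_coordinates
   below. *)
Record body (R : realType) := Body {
  body_carrier :> topologicalType;
  global_chart : body_carrier -> 'rV[R]_3;
  global_chartP : topological_chart setT global_chart
}.

Section Manifold.
Variables (R : realType) (B : body R).

Definition local_coordinates (V : set B) (x : B -> 'rV[R]_3) : Prop :=
  [/\ topological_chart V x,
      smooth (@global_chart R B @` V) (in_chart V (@global_chart R B) x) &
      smooth (x @` V) (in_chart V x (@global_chart R B))].

Definition smooth_fun (W : normedModType R) (f : B -> W) : Prop :=
  smooth (range (@global_chart R B)) (in_chart setT (@global_chart R B) f).

(* Every tangent space T_pB is identified with R^3 by the differential of the
   global chart: a vector of T_pB is the row of its components in the
   coordinate basis of the global chart at p. *)

Record one_form := OneForm {
  one_form_at :> B -> {scalar 'rV[R]_3};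
  one_form_smooth : forall v, smooth_fun (fun p => one_form_at p v : R)
}.

Record volume_form := VolumeForm {
  volume_at :> B -> 'rV[R]_3 -> 'rV[R]_3 -> 'rV[R]_3 -> R;
  volume_linear1 : forall p v w, scalar (fun u => volume_at p u v w);
  volume_linear2 : forall p u w, scalar (fun v => volume_at p u v w);
  volume_linear3 : forall p u v, scalar (fun w => volume_at p u v w);
  volume_alt12 : forall p u w, volume_at p u u w = 0;
  volume_alt23 : forall p u v, volume_at p u v v = 0;
  volume_alt13 : forall p u v, volume_at p u v u = 0;
  volume_smooth : forall u v w, smooth_fun (fun p => volume_at p u v w);
  volume_neq0 : forall p, exists u v w, volume_at p u v w != 0
}.

Definition lin_indep_at (w1 w2 : one_form) (p : B) : Prop :=
  forall a b : R, (forall v, a * w1 p v + b * w2 p v = 0) -> a = 0 /\ b = 0.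

(* d w (u, v) = u (w v) - v (w u) for the vector fields u, v with constant
   components in the global chart (which commute). *)
Definition ext_derivative (w : one_form) (p : B) (u v : 'rV[R]_3) : R :=
  'D_u (in_chart setT (@global_chart R B) (fun q => w q v : R))
    (global_chart p) -
  'D_v (in_chart setT (@global_chart R B) (fun q => w q u : R))
    (global_chart p).

Definition closed_form (w : one_form) : Prop :=
  forall p u v, ext_derivative w p u v = 0.

(* A linear frame (v_1, v_2, v_3) at p is the invertible matrix whose rows are
   v_1, v_2, v_3; rows are numbered from 0. *)
Definition linear_frame (F : 'M[R]_3) : Prop := F \in unitmx.

(* The frame (d/dx^1, d/dx^2, d/dx^3) at p of the coordinates (V, x): the i-th
   vector is the i-th partial derivative of global_chart o x^-1 at x(p). *)
Definition coordinate_frame (V : set B) (x : B -> 'rV[R]_3) (p : B) : 'M[R]_3 :=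
  \matrix_(i < 3)
    'D_(basis_vec R i) (in_chart V x (@global_chart R B)) (x p).

(* P p is the set of the frames at p which belong to P. *)
Definition integrable_structure (P : B -> set 'M[R]_3) : Prop :=
  forall p, exists (V : set B) (x : B -> 'rV[R]_3),
    [/\ V p, local_coordinates V x &
        forall q, V q -> P q (coordinate_frame V x q)].

Definition G3C_structure (w1 w2 : one_form) (Om : volume_form) (p : B) :
    set 'M[R]_3 :=
  [set F | let v1 := row 0 F in let v2 := row 1 F in let v3 := row 2 F in
    [/\ linear_frame F,
        [/\ w1 p v2 = 1, w1 p v1 = 0 & w1 p v3 = 0],
        [/\ w2 p v3 = 1, w2 p v1 = 0 & w2 p v2 = 0] &
        Om p v1 v2 v3 = 1]].

End Manifold.

(* The isotropy group of e^2, e^3 and e^1 /\ e^2 /\ e^3, the latter being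
   the determinant of the matrix X whose columns are its three arguments. *)
Definition G3C (R : realType) : set 'M[R]_3 :=
  [set A | [/\ A \in unitmx,
               (forall x : 'cV[R]_3, (A *m x) 1 0 = x 1 0),
               (forall x : 'cV[R]_3, (A *m x) 2 0 = x 2 0) &
               (forall X : 'M[R]_3, \det (A *m X) = \det X)]].

Section Reduction.
Variables (R : realType) (B : body R).

Let lift_01 : lift 0 (0 : 'I_2) = 1 :> 'I_3. Proof. exact: val_inj. Qed.
Let lift_02 : lift 0 (lift 0 (0 : 'I_1)) = 2 :> 'I_3.
Proof. exact: val_inj. Qed.
Let lift_10 : lift (1 : 'I_3) (0 : 'I_2) = 0. Proof. exact: val_inj. Qed.
Let lift_12 : lift (1 : 'I_3) (1 : 'I_2) = 2. Proof. exact: val_inj. Qed.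
Let lift_20 : lift (2 : 'I_3) (0 : 'I_2) = 0. Proof. exact: val_inj. Qed.
Let lift_21 : lift (2 : 'I_3) (1 : 'I_2) = 1. Proof. exact: val_inj. Qed.
Let lift_00 : lift 0 (0 : 'I_1) = 1 :> 'I_2. Proof. exact: val_inj. Qed.
Let lift_0h : lift 0 (1 : 'I_2) = 2 :> 'I_3. Proof. exact: val_inj. Qed.
Let lift_11 : lift (1 : 'I_2) (0 : 'I_1) = 0. Proof. exact: val_inj. Qed.

Let ord3E := (lift_02, lift_00, lift_01, lift_0h, lift_10, lift_12, lift_20,
  lift_21, lift_11).

Let sum3E (V : zmodType) (f : 'I_3 -> V) : \sum_i f i = f 0 + (f 1 + f 2).
Proof. by rewrite !big_ord_recl big_ord0 addr0 ?ord3E. Qed.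

Let row_mul3 n (M : 'M[R]_(n, 3)) (F : 'M[R]_3) i : row i (M *m F) =
  M i 0 *: row 0 F + (M i 1 *: row 1 F + M i 2 *: row 2 F).
Proof. by rewrite row_mul mulmx_sum_row sum3E !mxE. Qed.

Let ord3P (P : 'I_3 -> Prop) : P 0 -> P 1 -> P 2 -> forall i, P i.
Proof.
move=> P0 P1 P2 [[|[|[|//]]] i3].
- by rewrite (_ : Ordinal i3 = 0) //; apply: val_inj.
- by rewrite (_ : Ordinal i3 = 1) //; apply: val_inj.
- by rewrite (_ : Ordinal i3 = 2) //; apply: val_inj.
Qed.

Lemma volume_det (Om : volume_form B) p (M F : 'M[R]_3) :
  Om p (row 0 (M *m F)) (row 1 (M *m F)) (row 2 (M *m F)) =
  \det M * Om p (row 0 F) (row 1 F) (row 2 F).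
Proof.
have D1 u u' v w : Om p (u + u') v w = Om p u v w + Om p u' v w.
  by have := volume_linear1 Om p v w 1 u u'; rewrite scale1r mul1r.
have D2 u v v' w : Om p u (v + v') w = Om p u v w + Om p u v' w.
  by have := volume_linear2 Om p u w 1 v v'; rewrite scale1r mul1r.
have D3 u v w w' : Om p u v (w + w') = Om p u v w + Om p u v w'.
  by have := volume_linear3 Om p u v 1 w w'; rewrite scale1r mul1r.
have Z01 v w : Om p 0 v w = 0.
  by apply: (addIr (Om p 0 v w)); rewrite add0r -D1 addr0.
have Z02 u w : Om p u 0 w = 0.
  by apply: (addIr (Om p u 0 w)); rewrite add0r -D2 addr0.
have Z03 u v : Om p u v 0 = 0.
  by apply: (addIr (Om p u v 0)); rewrite add0r -D3 addr0.
have S1 a u v w : Om p (a *: u) v w = a * Om p u v w.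
  by have := volume_linear1 Om p v w a u 0; rewrite !addr0 Z01 addr0.
have S2 a u v w : Om p u (a *: v) w = a * Om p u v w.
  by have := volume_linear2 Om p u w a v 0; rewrite !addr0 Z02 addr0.
have S3 a u v w : Om p u v (a *: w) = a * Om p u v w.
  by have := volume_linear3 Om p u v a w 0; rewrite !addr0 Z03 addr0.
have A12 u v w : Om p v u w = - Om p u v w.
  have := volume_alt12 Om p (u + v) w.
  rewrite D1 !D2 !volume_alt12 add0r addr0 => /eqP.
  by rewrite addrC addr_eq0 => /eqP.
have A23 u v w : Om p u w v = - Om p u v w.
  have := volume_alt23 Om p u (v + w).
  rewrite D2 !D3 !volume_alt23 add0r addr0 => /eqP.
  by rewrite addrC addr_eq0 => /eqP.
rewrite !row_mul3; set a := row 0 F; set b := row 1 F; set c := row 2 F.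
rewrite !(D1, D2, D3, S1, S2, S3) !volume_alt12 !volume_alt23 !volume_alt13.
have -> : Om p c b a = - Om p a b c by rewrite A12 A23 A12 !opprK.
have -> : Om p b c a = Om p a b c by rewrite A23 A12 opprK.
have -> : Om p c a b = Om p a b c by rewrite A12 A23 opprK.
rewrite (A12 a b) (A23 a b).
have -> : \det M = M 0 0 * (M 1 1 * M 2 2 - M 1 2 * M 2 1)
   - M 0 1 * (M 1 0 * M 2 2 - M 1 2 * M 2 0)
   + M 0 2 * (M 1 0 * M 2 1 - M 1 1 * M 2 0).
  rewrite (expand_det_row _ 0) !big_ord_recl big_ord0 /cofactor.
  rewrite !(expand_det_row _ 0) !big_ord_recl !big_ord0 /cofactor !det_mx11 !mxE.
  rewrite ?ord3E /=.
  rewrite /bump /=; ring.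
ring.
Qed.

Let G3C_entries (A : 'M[R]_3) : G3C A <->
  [/\ A \in unitmx, [/\ A 1 1 = 1, A 1 0 = 0 & A 1 2 = 0],
      [/\ A 2 2 = 1, A 2 0 = 0 & A 2 1 = 0] & \det A = 1].
Proof.
split=> [[Au A1 A2 Ad]|[Au [a1 a0 a2] [b2 b0 b1] Ad]].
  have E i j : A i j = (A *m delta_mx j 0 : 'cV_3) i 0.
    by rewrite -colE mxE.
  split; rewrite // ?E ?A1 ?A2 ?mxE //=.
  by rewrite -(mulmx1 A) Ad det1.
split=> // [x|x|X]; last by rewrite det_mulmx Ad mul1r.
  by rewrite mxE sum3E a0 a1 a2 !mul0r mul1r add0r addr0.
by rewrite mxE sum3E b0 b1 b2 !mul0r mul1r !add0r.
Qed.

(* The fibres of G3C_structure are the orbits of the right action of G3C on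
   linear frames, (F . A)_j = \sum_i A i j *: F_i. *)
Lemma G3C_structure_orbit (w1 w2 : one_form B) (Om : volume_form B) p
    (F F' : 'M[R]_3) :
  G3C_structure w1 w2 Om p F ->
  G3C_structure w1 w2 Om p F' <-> exists2 A, G3C A & F' = A^T *m F.
Proof.
case=> Fu [a1 a0 a2] [b2 b0 b1] Om1.
have E1 (A : 'M[R]_3) i : w1 p (row i (A^T *m F)) = A 1 i.
  rewrite row_mul3 !linearD !linearZ /= a0 a1 a2 !mulr0 mulr1 add0r addr0.
  by rewrite mxE.
have E2 (A : 'M[R]_3) i : w2 p (row i (A^T *m F)) = A 2 i.
  rewrite row_mul3 !linearD !linearZ /= b0 b1 b2 !mulr0 mulr1 !add0r.
  by rewrite mxE.
split=> [P'|[A /G3C_entries[Au [A1 A0 A2] [B2 B0 B1] Ad] ->]]; last first.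
  split; rewrite ?E1 ?E2 //; last by rewrite volume_det det_tr Ad Om1 mul1r.
  by rewrite /linear_frame unitmx_mul unitmx_tr Au.
exists (F' *m invmx F)^T; last by rewrite trmxK mulmxKV.
have F'E : F' = (F' *m invmx F)^T^T *m F by rewrite trmxK mulmxKV.
apply/G3C_entries; move: P'; rewrite {1}F'E; set A := (_)^T.
case; rewrite !E1 !E2 volume_det Om1 mulr1 det_tr => A'u A1 A2 Ad.
by split=> //; move: A'u; rewrite /linear_frame unitmx_mul unitmx_tr => /andP[].
Qed.

Lemma G3C_structure_nonempty (w1 w2 : one_form B) (Om : volume_form B) p :
  lin_indep_at w1 w2 p -> G3C_structure w1 w2 Om p !=set0.
Proof.
move=> w12.
pose N : 'M[R]_(2, 3) :=
  \matrix_(j, i) (if j == 0 then w1 p else w2 p) (delta_mx 0 i).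
have wE (w : {scalar 'rV[R]_3}) v : w v = \sum_i v 0 i * w (delta_mx 0 i).
  rewrite {1}(row_sum_delta v) linear_sum.
  by apply: eq_bigr => i _; rewrite linearZ.
have N1 v : (v *m N^T) 0 0 = w1 p v.
  by rewrite mxE (wE (w1 p)); apply: eq_bigr => i _; rewrite !mxE.
have N2 v : (v *m N^T) 0 1 = w2 p v.
  by rewrite mxE (wE (w2 p)); apply: eq_bigr => i _; rewrite !mxE.
have Nfree : row_free N.
  apply: inj_row_free => x xN.
  have [|x0 x1] := w12 (x 0 0) (x 0 1).
    move=> v; rewrite -N1 -N2; move/matrixP: xN => xN.
    rewrite !mxE !mulr_sumr -big_split big1 //= => i _.
    have := xN 0 i; rewrite !mxE !big_ord_recl big_ord0 !mxE !ord3E /=.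
    move=> h; transitivity (v 0 i * 0); last by rewrite mulr0.
    by rewrite -{}h; ring.
  by apply/rowP => -[[|[|//]] i2]; rewrite mxE;
    [rewrite -[RHS]x0|rewrite -[RHS]x1]; congr (x _ _); apply: val_inj.
have [L' NL] := row_freeP Nfree.
pose L := L'^T; have LN : L *m N^T = 1%:M by rewrite -trmx_mul NL trmx1.
have [v /sub_kermxP vN v0] : exists2 v : 'rV[R]_3, (v <= kermx N^T)%MS & v != 0.
  apply/rowV0Pn; rewrite -mxrank_eq0 mxrank_ker mxrank_tr.
  by move: Nfree; rewrite /row_free => /eqP ->.
pose F a : 'M[R]_3 := \matrix_i (if i == 0 then a else
  if i == 1 then row 0 L else row 1 L).
have F0 a : row 0 (F a) = a by rewrite rowK.
have F1 a : row 1 (F a) = row 0 L by rewrite rowK.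
have F2 a : row 2 (F a) = row 1 L by rewrite rowK.
have w1L i : w1 p (row i L) = (i == 0)%:R.
  by rewrite -N1 -row_mul LN !mxE.
have w2L i : w2 p (row i L) = (i == 1)%:R.
  by rewrite -N2 -row_mul LN !mxE.
have w1v : w1 p v = 0 by rewrite -N1 vN mxE.
have w2v : w2 p v = 0 by rewrite -N2 vN mxE.
have Fu a : a != 0 -> w1 p a = 0 -> w2 p a = 0 -> F a \in unitmx.
  move=> a0 w1a w2a; rewrite -row_free_unit; apply: inj_row_free => x xF.
  have := row_mul3 x (F a) 0; rewrite xF F0 F1 F2 row0 => /esym xF0.
  have := congr1 (w1 p) xF0; have := congr1 (w2 p) xF0.
  rewrite !linearD !linearZ !linear0 /= !w1L !w2L w1a w2a /=.
  rewrite !(mulr0, mulr1, add0r, addr0) => x2 x1.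
  move: xF0; rewrite x1 x2 !scale0r !addr0 => /eqP.
  rewrite scaler_eq0 (negbTE a0) orbF => /eqP x0.
  by apply/rowP; apply: ord3P; rewrite mxE.
have Om0 : Om p v (row 0 L) (row 1 L) != 0.
  have [a [b [c]]] := volume_neq0 Om p; apply: contraNneq => OmF.
  pose X : 'M[R]_3 := \matrix_i (if i == 0 then a else if i == 1 then b else c).
  have := volume_det Om p (X *m invmx (F v)) (F v).
  by rewrite mulmxKV ?Fu // F0 F1 F2 OmF mulr0 !rowK /= => ->.
pose k := (Om p v (row 0 L) (row 1 L))^-1.
exists (F (k *: v)); rewrite /G3C_structure /= F0 F1 F2.
split; rewrite ?w1L ?w2L ?linearZ /= ?w1v ?w2v ?mulr0 //.
  apply: Fu; rewrite ?linearZ /= ?w1v ?w2v ?mulr0 //.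
  by rewrite scaler_eq0 negb_or v0 andbT invr_eq0.
have := volume_linear1 Om p (row 0 L) (row 1 L) k v 0.
have := volume_linear1 Om p (row 0 L) (row 1 L) (-1) v v.
rewrite scaleN1r addNr mulN1r addNr !addr0 => -> ->.
by rewrite addr0 mulVf.
Qed.

End Reduction.

(* Main.v *)
Require Import Defs.
From HB Require Import structures.
From mathcomp Require Import all_boot all_order all_algebra.
From mathcomp Require Import all_classical all_reals all_analysis.
From mathcomp Require Import ring lra.

(* In the coordinates (x^1, x^2, x^3) of an adapted chart the forms are dx^2 and
   dx^3, hence closed.  Conversely, by the Poincare lemma closed forms are
   locally df1 and df2, and (c, f1, f2) are coordinates near p for a suitable
   linear function c.  The volume form is then h dc /\ df1 /\ df2, and replacing
   c by an antiderivative H of h with respect to c turns it into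
   dH /\ df1 /\ df2, so (H, f1, f2) is an adapted chart. *)

Set Implicit Arguments.
Unset Strict Implicit.
Unset Printing Implicit Defensive.

Import Order.TTheory GRing.Theory Num.Theory.
Import numFieldNormedType.Exports.

Local Open Scope classical_set_scope.
Local Open Scope ring_scope.

(** * Differential calculus in dimension three *)

(** The forms determine f1 and f2 up to constants, so only the first coordinate is free to normalise
    the volume. Replacing c by H multiplies the Jacobian determinant by the derivative of H along c
    alone; one integration in one variable therefore suffices, with f1 and f2 as parameters. It
    requires (c, f1, f2) to be genuine coordinates, hence one use of the inverse function theorem
    there and a second for (H, f1, f2), whose determinant is the nowhere vanishing density of the
    volume form. [smooth] is defined by iterated partial derivatives, so primitives and local
    inverses are shown smooth by induction on the order, each first derivative being expressed by
    objects already under control: for primitives, weighted integrals along a scaling, a family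
    closed under differentiation; for inverses, the inverse Jacobian matrix composed with the
    inverse map itself. *)

Lemma ord3_case (P : 'I_3 -> Prop) : P 0 -> P 1 -> P 2 -> forall i, P i.
Proof.
move=> P0 P1 P2 [[|[|[|//]]] i3].
- by rewrite (_ : Ordinal i3 = 0) //; apply: val_inj.
- by rewrite (_ : Ordinal i3 = 1) //; apply: val_inj.
- by rewrite (_ : Ordinal i3 = 2) //; apply: val_inj.
Qed.

(** The linear part of a first-order expansion is unique, so the candidate [df] must be the
    differential. This gives differentiability of maps known only through estimates. *)
Lemma differentiable_linear_approx (R : realFieldType) (V W : normedModType R)
    (f : V -> W) (df : {linear V -> W}) x : continuous df ->
  (forall e, 0 < e -> \forall v \near (0 : V),
    `|f (v + x) - f x - df v| <= e * `|v|) ->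
  differentiable f x /\ 'd f x = df :> (V -> W).
Proof.
move=> dfc h.
have dxf : f \o shift x = cst (f x) + df +o_ 0 id.
  apply/eqaddoP => e e0; apply: filterS (h e e0) => v.
  by rewrite !fctE opprD addrA.
have dE := diff_unique dfc dxf.
by split=> //; apply/diff_locallyP; rewrite dE.
Qed.

Section Calculus.
Variable R : realType.
Implicit Types (x y v : 'rV[R]_3) (U : set 'rV[R]_3) (W : normedModType R).

Lemma coord_le_norm n (v : 'rV[R]_n) j : `|v 0 j| <= `|v|.
Proof. by rewrite [leRHS]/Num.norm/= mx_normrE; exact: (le_bigmax _ _ (0, j)). Qed.

Lemma rV_norm_le n (v : 'rV[R]_n) c :
  0 <= c -> (forall j, `|v 0 j| <= c) -> `|v| <= c.
Proof.
move=> c0 vc; rewrite [leLHS]/Num.norm/= mx_normrE; apply: bigmax_le => // -[i j] _.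
by rewrite ord1; exact: vc.
Qed.

Lemma basis_vecE i j : basis_vec R i 0 j = (j == i)%:R.
Proof. by rewrite mxE. Qed.

Lemma rV3_sum v : v = \sum_j v 0 j *: basis_vec R j.
Proof. exact: row_sum_delta. Qed.

Lemma norm_basis_vec i : `|basis_vec R i| <= 1.
Proof.
apply: rV_norm_le => // j.
by rewrite basis_vecE; case: eqP; rewrite ?normr1 ?normr0.
Qed.

Lemma ball_mem (p : 'rV[R]_3) (e : R) y : ball p e y = (`|y - p| < e) :> Prop.
Proof. by rewrite -ball_normE /= distrC. Qed.

Lemma nbhs_norm_le (p : 'rV[R]_3) (A : set 'rV[R]_3) : nbhs p A ->
  exists2 r : R, 0 < r & forall x, `|x - p| <= r -> A x.
Proof.
move=> /nbhs_ballP[e /= e0 eA]; exists (e / 2); first by rewrite divr_gt0.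
move=> x xe; apply: eA; rewrite -ball_normE /= distrC (le_lt_trans xe) //.
by rewrite ltr_pdivrMr // ltr_pMr // ltr1n.
Qed.

Lemma open_norm_ball (a : 'rV[R]_3) (r : R) : open [set y | `|y - a| < r].
Proof.
have -> : [set y : 'rV[R]_3 | `|y - a| < r] = ball a r.
  by rewrite -ball_normE; apply/funext => y; rewrite /= distrC.
exact: ball_open.
Qed.

Lemma compact_norm_ball (a : 'rV[R]_3) (r : R) : 0 < r ->
  compact [set y | `|y - a| <= r].
Proof.
move=> r0; have -> : [set y : 'rV[R]_3 | `|y - a| <= r] = closed_ball a r.
  by rewrite closed_ballE //; apply/funext => y; rewrite /closed_ball_ /= distrC.
apply: bounded_closed_compact; last exact: closed_ball_closed.
exists (`|a| + r); split; first exact: num_real.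
move=> M Mr y; rewrite closed_ballE // /closed_ball_ /= => ya.
apply: le_trans (ltW Mr); rewrite -[y](subrK a) addrC.
by rewrite (le_trans (ler_normD _ _)) // lerD // distrC.
Qed.

Lemma derive_basis_sum W (f : 'rV[R]_3 -> W) x v : differentiable f x ->
  'D_v f x = \sum_j v 0 j *: 'D_(basis_vec R j) f x.
Proof.
move=> df; rewrite deriveE // {1}(rV3_sum v) linear_sum.
by apply: eq_bigr => j _; rewrite linearZ /= deriveE.
Qed.

Lemma frechet_remainder W (f : 'rV[R]_3 -> W) x : differentiable f x ->
  forall e, 0 < e -> \forall v \near (0 : 'rV[R]_3),
    `|f (v + x) - f x - 'D_v f x| <= e * `|v|.
Proof.
move=> df; have := diff_locally df => /eqaddoP h e e0.
apply: filterS (h _ e0) => v; rewrite deriveE //=.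
by rewrite !fctE opprD addrA.
Qed.

Lemma differentiable_frechet W (f : 'rV[R]_3 -> W) x (a : 'I_3 -> W) :
  (forall e, 0 < e -> \forall v \near (0 : 'rV[R]_3),
    `|f (v + x) - f x - \sum_j v 0 j *: a j| <= e * `|v|) ->
  differentiable f x /\ forall i, 'D_(basis_vec R i) f x = a i.
Proof.
move=> h.
pose L (v : 'rV[R]_3) : W := \sum_j v 0 j *: a j.
have lin : linear L.
  move=> c u v; rewrite /L scaler_sumr -big_split /=; apply: eq_bigr => j _.
  by rewrite !mxE scalerDl scalerA.
pose Lm := GRing.isLinear.Build _ _ _ _ L lin.
pose df : {linear 'rV[R]_3 -> W} := HB.pack L Lm.
have dfc : continuous df.
  move=> v; apply: differentiable_continuous.
  rewrite (_ : (df : _ -> _) = \sum_j (fun v : 'rV[R]_3 => v 0 j *: a j)); last first.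
    by apply/funext => u; rewrite fct_sumE.
  apply: differentiable_sum => j; apply: differentiableZl.
  exact: differentiable_coord.
have [fd dE] := differentiable_linear_approx dfc h.
split=> // i; rewrite deriveE // dE /= /L (bigD1 i) //= big1.
  by rewrite basis_vecE eqxx scale1r addr0.
by move=> j ji; rewrite basis_vecE (negbTE ji) scale0r.
Qed.

Lemma derive_dirZ W (f : 'rV[R]_3 -> W) x (c : R) v : differentiable f x ->
  'D_(c *: v) f x = c *: 'D_v f x.
Proof. by move=> df; rewrite (deriveE _ df) (deriveE v df) linearZ. Qed.

Lemma is_derive_line W (f : 'rV[R]_3 -> W) x v (t : R) :
  differentiable f (x + t *: v) ->
  is_derive t 1 (fun s : R => f (x + s *: v)) ('D_v f (x + t *: v)).
Proof.
move=> df.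
pose fl (s : R) := f (x + s *: v).
have E : (fun h : R => h^-1 *: ((fl \o shift t) (h *: 1) - fl t)) =
    (fun h : R => h^-1 *: ((f \o shift (x + t *: v)) (h *: v) - f (x + t *: v))).
  apply/funext => h /=; congr (_ *: (f _ - _)).
  by rewrite [h *: 1]mulr1 scalerDl addrCA.
rewrite -/fl; apply: DeriveDef; rewrite /derivable /derive E //.
exact: diff_derivable.
Qed.

Lemma MVT_line (f : 'rV[R]_3 -> R) x v :
  (forall t : R, 0 <= t <= 1 -> differentiable f (x + t *: v)) ->
  exists2 t : R, 0 <= t <= 1 & f (x + v) - f x = 'D_v f (x + t *: v).
Proof.
move=> df.
have [| |c c01] := @MVT_segment R (fun s : R => f (x + s *: v))
    (fun s => 'D_v f (x + s *: v)) 0 1 ler01.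
- move=> t; rewrite in_itv /= => /andP[/ltW t0 /ltW t1].
  by apply: is_derive_line; apply: df; rewrite t0.
- apply: derivable_within_continuous => t; rewrite in_itv /= => t01.
  by have [] := is_derive_line (df t t01).
rewrite scale1r scale0r addr0 subr0 mulr1 => E.
by exists c => //; move: c01; rewrite in_itv.
Qed.

Lemma ball_segment (a : 'rV[R]_3) (r : R) x v (t : R) : 0 <= t <= 1 ->
  `|x - a| <= r -> `|x + v - a| <= r -> `|x + t *: v - a| <= r.
Proof.
move=> /andP[t0 t1] xr xvr.
have -> : x + t *: v - a = (1 - t) *: (x - a) + t *: (x + v - a).
  by apply/rowP => i; rewrite !mxE; ring.
rewrite (le_trans (ler_normD _ _))// !normrZ !ger0_norm ?subr_ge0 //.
by have -> : r = (1 - t) * r + t * r by [ring]; rewrite lerD// ler_wpM2l// subr_ge0.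
Qed.

(** The norm is the maximum of the coordinates, so each of the three terms of the expansion along
    the basis is at most [|v|] times [M]; hence the factor 3. *)
Lemma derive_norm_le (f : 'rV[R]_3 -> R) x v (M : R) : differentiable f x ->
  (forall i, `|'D_(basis_vec R i) f x| <= M) -> `|'D_v f x| <= 3 * M * `|v|.
Proof.
move=> df fM; rewrite derive_basis_sum //.
apply: le_trans (ler_norm_sum _ _ _) _.
have -> : 3 * M * `|v| = \sum_(j < 3) `|v| * M.
  by rewrite sumr_const card_ord -mulr_natl; ring.
apply: ler_sum => j _; rewrite normrZ; apply: ler_pM => //; exact: coord_le_norm.
Qed.

Lemma lipschitz_ball (f : 'rV[R]_3 -> R) (a : 'rV[R]_3) (r M : R) :
  (forall x, `|x - a| <= r -> differentiable f x) ->
  (forall x i, `|x - a| <= r -> `|'D_(basis_vec R i) f x| <= M) ->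
  forall x y, `|x - a| <= r -> `|y - a| <= r ->
    `|f x - f y| <= 3 * M * `|x - y|.
Proof.
move=> df fM x y xr yr.
have xE : x = y + (x - y) by rewrite addrC subrK.
have inr (t : R) : 0 <= t <= 1 -> `|y + t *: (x - y) - a| <= r.
  by move=> t01; apply: ball_segment; rewrite // -xE.
have [t t01] : exists2 t : R, 0 <= t <= 1 &
    f (y + (x - y)) - f y = 'D_(x - y) f (y + t *: (x - y)).
  by apply: MVT_line => t t01; apply: df; exact: inr.
rewrite -xE => ->; apply: derive_norm_le; first by apply: df; exact: inr.
by move=> i; apply: fM; exact: inr.
Qed.

End Calculus.

(** * Functions of class C^k *)

Section CkTheory.
Variable R : realType.
Implicit Types (x y v : 'rV[R]_3) (U : set 'rV[R]_3) (W : normedModType R).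

Lemma Ck_subset W k U U' (f : 'rV[R]_3 -> W) : U' `<=` U -> Ck k U f -> Ck k U' f.
Proof.
move=> UU'; elim: k f => [|k IH] f /=; first by move=> h x /UU'; exact: h.
by move=> [df dk]; split=> [x /UU'|i]; [exact: df|apply: IH].
Qed.

Lemma eq_derive_open W U (f g : 'rV[R]_3 -> W) x v : open U -> {in U, f =1 g} ->
  U x -> 'D_v f x = 'D_v g x.
Proof.
move=> oU fg Ux; apply: near_eq_derive.
by apply: filterS (open_nbhs_nbhs (conj oU Ux)) => y Uy; apply: fg; rewrite inE.
Qed.

Lemma eq_differentiable_open W U (f g : 'rV[R]_3 -> W) x : open U ->
  {in U, f =1 g} -> U x -> differentiable f x -> differentiable g x.
Proof.
move=> oU fg Ux df.
have U0 : \forall v \near (0 : 'rV[R]_3), U (v + x).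
  have /nbhs_ballP[e /= e0 eU] := open_nbhs_nbhs (conj oU Ux).
  apply: filterS (nbhs0_lt e0) => v ve; apply: eU.
  by rewrite -ball_normE /= opprD addrCA subrr addr0 normrN.
suff [] : differentiable g x /\ 'd g x = 'd f x :> (_ -> _) by [].
apply: differentiable_linear_approx => [|e e0]; first exact: diff_continuous.
apply: filterS2 (frechet_remainder df e0) U0 => v.
by rewrite deriveE // => h Uv; rewrite -!fg ?inE.
Qed.

(** Derivative formulas hold only on [U], whereas [Ck] takes total functions; this carries
    regularity across an equality valid on [U] alone. *)
Lemma eq_Ck W k U (f g : 'rV[R]_3 -> W) : open U -> {in U, f =1 g} ->
  Ck k U f -> Ck k U g.
Proof.
move=> oU; elim: k f g => [|k IH] f g fg /=.
  move=> cf x Ux; have := cf x Ux; rewrite /prop_for /continuous_at.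
  rewrite fg ?inE // => h; apply: cvg_trans h.
  apply: (@near_eq_cvg _ _ (nbhs x)); near=> y.
  by apply: fg; rewrite inE; near: y; exact: (open_nbhs_nbhs (conj oU Ux)).
move=> [df dk]; split=> [x Ux|i].
  exact: (eq_differentiable_open oU fg Ux (df x Ux)).
apply: IH (dk i) => x; rewrite inE => Ux; exact: (eq_derive_open _ oU fg Ux).
Unshelve. all: by end_near.
Qed.

Lemma CkW W k U (f : 'rV[R]_3 -> W) : Ck k.+1 U f -> Ck k U f.
Proof.
elim: k f => [|k IH] f [df dk].
  by move=> x Ux; apply: differentiable_continuous; exact: df.
by split=> // i; apply: IH.
Qed.

Lemma smooth_differentiable W U (f : 'rV[R]_3 -> W) x : smooth U f -> U x ->
  differentiable f x.
Proof. by move=> /(_ 1%N)[df _]; exact: df. Qed.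

Lemma smooth_derive W U (f : 'rV[R]_3 -> W) i : smooth U f ->
  smooth U ('D_(basis_vec R i) f).
Proof. by move=> sf k; have [_ fk] := sf k.+1; exact: fk. Qed.

Lemma smooth_continuous W U (f : 'rV[R]_3 -> W) x : smooth U f -> U x ->
  {for x, continuous f}.
Proof. by move=> sf; exact: (sf 0%N x). Qed.

Lemma Ck_cst W k U (c : W) : Ck k U (fun=> c).
Proof.
elim: k c => [|k IH] c /=; first by move=> x _; exact: cst_continuous.
split=> [x _|i]; first exact: differentiable_cst.
rewrite (_ : 'D_(basis_vec R i) (fun=> c) = fun=> 0); first exact: IH.
by apply/funext => x; rewrite derive_cst.
Qed.

Lemma CkD W k U (f g : 'rV[R]_3 -> W) : open U -> Ck k U f -> Ck k U g ->
  Ck k U (fun x => f x + g x).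
Proof.
move=> oU; elim: k f g => [|k IH] f g /=.
  by move=> cf cg x Ux; apply: continuousD; [exact: cf|exact: cg].
move=> [df fk] [dg gk]; split=> [x Ux|i].
  by apply: differentiableD; [exact: df|exact: dg].
apply: eq_Ck (IH _ _ (fk i) (gk i)) => // x; rewrite inE => Ux.
rewrite -[fun x => f x + g x]/(f + g) deriveD //.
  by apply: diff_derivable; exact: df.
by apply: diff_derivable; exact: dg.
Qed.

Lemma Ck_sum W k U (I : Type) (r : seq I) (P : pred I) (f : I -> 'rV[R]_3 -> W) :
  open U -> (forall i, P i -> Ck k U (f i)) ->
  Ck k U (fun x => \sum_(i <- r | P i) f i x).
Proof.
move=> oU fk; elim: r => [|i r IH].
  by apply: eq_Ck (Ck_cst k U 0) => // x _; rewrite big_nil.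
have [Pi|nPi] := boolP (P i); last first.
  by apply: eq_Ck IH => // x _; rewrite big_cons (negbTE nPi).
by apply: eq_Ck (CkD oU (fk i Pi) IH) => // x _; rewrite big_cons Pi.
Qed.

Lemma CkM k U (f g : 'rV[R]_3 -> R) : open U -> Ck k U f -> Ck k U g ->
  Ck k U (fun x => f x * g x).
Proof.
move=> oU; elim: k f g => [|k IH] f g.
  by move=> cf cg x Ux; apply: continuousM; [exact: cf|exact: cg].
move=> fS gS; have [df fk] := fS; have [dg gk] := gS; split=> [x Ux|i].
  by apply: differentiableM; [exact: df|exact: dg].
apply: eq_Ck (CkD oU (IH _ _ (CkW fS) (gk i)) (IH _ _ (CkW gS) (fk i))) => // x.
rewrite inE => Ux; rewrite -[fun x => f x * g x]/(f * g) deriveM //.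
  by apply: diff_derivable; exact: df.
by apply: diff_derivable; exact: dg.
Qed.

Lemma CkB k U (f g : 'rV[R]_3 -> R) : open U -> Ck k U f -> Ck k U g ->
  Ck k U (fun x => f x - g x).
Proof.
move=> oU fk gk; apply: eq_Ck (CkD oU fk (CkM oU (Ck_cst k U (-1 : R)) gk)) => // x _.
by rewrite mulN1r.
Qed.

Lemma Ck_prod k U (I : Type) (r : seq I) (P : pred I) (f : I -> 'rV[R]_3 -> R) :
  open U -> (forall i, P i -> Ck k U (f i)) ->
  Ck k U (fun x => \prod_(i <- r | P i) f i x).
Proof.
move=> oU fk; elim: r => [|i r IH].
  by apply: eq_Ck (Ck_cst k U (1 : R)) => // x _; rewrite big_nil.
have [Pi|nPi] := boolP (P i); last first.
  by apply: eq_Ck IH => // x _; rewrite big_cons (negbTE nPi).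
by apply: eq_Ck (CkM oU (fk i Pi) IH) => // x _; rewrite big_cons Pi.
Qed.

(** The derivative of 1/f is - f' / f^2, which contains 1/f only undifferentiated, so the induction
    hypothesis covers it. *)
Lemma CkV k U (f : 'rV[R]_3 -> R) : open U -> (forall x, U x -> f x != 0) ->
  Ck k U f -> Ck k U (fun x => (f x)^-1).
Proof.
move=> oU f0; elim: k => [|k IH].
  by move=> cf x Ux; apply: continuousV; [exact: f0|exact: cf].
move=> fS; have [df fk] := fS; split=> [x Ux|i].
  by apply: differentiableV; [exact: df|exact: f0].
have fV := IH (CkW fS).
apply: eq_Ck (CkM oU (CkM oU (Ck_cst k U (-1 : R)) (CkM oU fV fV)) (fk i)) => // x.
rewrite inE => Ux; rewrite (deriveV (f0 x Ux)); last first.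
  by apply: diff_derivable; exact: df.
by rewrite mulN1r /GRing.scale /= expr2 invfM.
Qed.

Lemma Ck_det k U n (M : 'rV[R]_3 -> 'M[R]_n) : open U ->
  (forall i j, Ck k U (fun x => M x i j)) -> Ck k U (fun x => \det (M x)).
Proof.
move=> oU Mk; rewrite /determinant; apply: Ck_sum => // s _.
apply: CkM => //; first exact: Ck_cst.
by apply: Ck_prod => // i _.
Qed.

(** Cramer's rule: an entry of the inverse is a cofactor divided by the determinant. *)
Lemma Ck_invmx k U n (M : 'rV[R]_3 -> 'M[R]_n) : open U ->
  (forall x, U x -> M x \in unitmx) ->
  (forall i j, Ck k U (fun x => M x i j)) ->
  forall i j, Ck k U (fun x => invmx (M x) i j).
Proof.
move=> oU Mu Mk i j.
have D0 x : U x -> \det (M x) != 0 by move=> /Mu; rewrite unitmxE unitfE.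
have adjk : Ck k U (fun x => \adj (M x) i j).
  suff : Ck k U (fun x => (-1) ^+ (j + i) * \det (row' j (col' i (M x)))).
    by apply: eq_Ck => // x _; rewrite mxE.
  apply: CkM => //; first exact: Ck_cst.
  apply: Ck_det => // i' j'.
  by apply: eq_Ck (Mk (lift j i') (lift i j')) => // x _; rewrite !mxE.
apply: eq_Ck (CkM oU (CkV oU D0 (Ck_det oU Mk)) adjk) => // x; rewrite inE => Ux.
by rewrite /invmx (Mu x Ux) [RHS]mxE. 
Qed.

Lemma differentiable_rV (f : 'rV[R]_3 -> 'rV[R]_3) x :
  differentiable f x <-> forall j, differentiable (fun y => f y 0 j : R) x.
Proof.
split=> [df j|df].
  exact: (@differentiable_comp _ _ _ _ f (fun M => M 0 j : R) x df
    (differentiable_coord _ _ _)).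
rewrite (_ : f = \sum_j (fun y => f y 0 j *: basis_vec R j)).
  by apply: differentiable_sum => j; apply: differentiableZl.
by apply/funext => y; rewrite fct_sumE -rV3_sum.
Qed.

Lemma derive_coord (f : 'rV[R]_3 -> 'rV[R]_3) x v j : differentiable f x ->
  'D_v f x 0 j = 'D_v (fun y => f y 0 j) x.
Proof. by move=> df; rewrite derive_mx ?mxE //; exact: diff_derivable. Qed.

Lemma derive_coordinate (x v : 'rV[R]_3) j : 'D_v (fun y : 'rV[R]_3 => y 0 j) x = v 0 j.
Proof. by rewrite -(@derive_coord id) ?derive_id. Qed.

Lemma Ck_coord k U j : open U -> Ck k U (fun x => x 0 j : R).
Proof.
move=> oU; case: k => [|k]; first by move=> x _; exact: coord_continuous.
split=> [x _|i]; first exact: differentiable_coord.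
apply: eq_Ck (Ck_cst k U (basis_vec R i 0 j)) => // x _.
by rewrite derive_coordinate.
Qed.

Lemma Ck_rV k U (f : 'rV[R]_3 -> 'rV[R]_3) : open U ->
  Ck k U f <-> forall j, Ck k U (fun y => f y 0 j).
Proof.
move=> oU; elim: k f => [|k IH] f.
  split=> [cf j x Ux|cf x Ux].
    by have := @continuous_comp _ _ _ f (fun M : 'rV[R]_3 => M 0 j) x (cf x Ux)
      (@coord_continuous R 1 3 0 j (f x)); apply.
  apply/(@cvgrPdist_le _ _ _ (nbhs x)) => e e0.
  have : \forall y \near x, forall j, `|f x 0 j - f y 0 j| <= e.
    apply: (@filter_forall _ _ (fun j y => `|f x 0 j - f y 0 j| <= e) (nbhs x)) => j.
    have /(@cvgrPdist_le _ _ _ (nbhs x)) h := cf j x Ux; exact: h.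
  apply: (@filterS _ (nbhs x)) => y h; apply: rV_norm_le; first exact: ltW.
  by move=> j; rewrite !mxE.
split=> [[df fk] j|fj].
  split=> [x /df /differentiable_rV //|i].
  have /IH /(_ j) := fk i; apply: eq_Ck => // x; rewrite inE => Ux.
  by rewrite derive_coord //; exact: df.
have df x : U x -> differentiable f x.
  by move=> Ux; apply/differentiable_rV => j; have [h _] := fj j; exact: h.
split=> // i; apply/IH => j; have [_ h] := fj j.
apply: eq_Ck (h i) => // x; rewrite inE => Ux.
by rewrite derive_coord //; exact: df.
Qed.

Lemma derive_comp W (f : 'rV[R]_3 -> W) (g : 'rV[R]_3 -> 'rV[R]_3) x v :
  differentiable g x -> differentiable f (g x) ->
  'D_v (fun y => f (g y)) x = 'D_('D_v g x) f (g x).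
Proof.
move=> dg df; rewrite -[fun y => f (g y)]/(f \o g).
rewrite (deriveE v (differentiable_comp dg df)) (deriveE v dg) (deriveE _ df).
exact: (congr1 (@^~ v) (diff_comp dg df)).
Qed.

Lemma Ck_comp k U V (f : 'rV[R]_3 -> R) (g : 'rV[R]_3 -> 'rV[R]_3) :
  open U -> open V -> (forall x, U x -> V (g x)) ->
  Ck k U g -> Ck k V f -> Ck k U (fun x => f (g x)).
Proof.
move=> oU oV gUV; elim: k f => [|k IH] f.
  move=> cg cf x Ux; apply: continuous_comp; first exact: cg.
  by apply: cf; exact: gUV.
move=> gS [df fk]; have [dg gk] := gS; split=> [x Ux|i].
  by apply: (@differentiable_comp _ _ _ _ g f); [exact: dg|apply: df; exact: gUV].
have : Ck k U (fun x => \sum_j 'D_(basis_vec R i) g x 0 j * 'D_(basis_vec R j) f (g x)).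
  apply: Ck_sum => // j _; apply: CkM => //; last exact: IH (CkW gS) (fk j).
  by have /Ck_rV := gk i; apply.
apply: eq_Ck => // x; rewrite inE => Ux.
rewrite (derive_comp _ (dg x Ux) (df _ (gUV x Ux))).
by rewrite (derive_basis_sum _ (df _ (gUV x Ux))).
Qed.

Lemma smooth_derive_dir U (f : 'rV[R]_3 -> R) v :
  open U -> smooth U f -> smooth U ('D_v f).
Proof.
move=> oU sf k.
have : Ck k U (fun x => \sum_j v 0 j * 'D_(basis_vec R j) f x).
  apply: Ck_sum => // j _; apply: CkM => //; first exact: Ck_cst.
  exact: smooth_derive.
apply: eq_Ck => // x; rewrite inE => Ux.
by rewrite (derive_basis_sum v (smooth_differentiable sf Ux)).
Qed.

End CkTheory.

(** * Symmetry of second derivatives *)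

Section Schwarz.
Variable R : realType.
Implicit Types (x y v : 'rV[R]_3) (U : set 'rV[R]_3).

(** The mean value theorem is applied twice: to the increment in direction [j] as a function of the
    displacement along [i], then to the derivative along [i]. The intermediate points stay in a box
    of side [s] at [x], hence the radius [2 * s]. *)
Lemma second_difference U (f : 'rV[R]_3 -> R) x i j (s : R) :
  smooth U f -> 0 <= s ->
  (forall y, `|y - x| <= 2 * s -> U y) ->
  exists2 y, `|y - x| <= 2 * s &
    f (x + s *: basis_vec R j + s *: basis_vec R i) - f (x + s *: basis_vec R i)
      - (f (x + s *: basis_vec R j) - f x) =
    s * (s * 'D_(basis_vec R j) ('D_(basis_vec R i) f) y).
Proof.
move=> sf s0 xU.
set ei := basis_vec R i; set ej := basis_vec R j.
have near_x (p q : R) : 0 <= p <= 1 -> 0 <= q <= 1 ->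
    `|x + p *: (s *: ei) + q *: (s *: ej) - x| <= 2 * s.
  move=> /andP[p0 p1] /andP[q0 q1].
  rewrite addrC !addrA addNr add0r (le_trans (ler_normD _ _))//.
  have le1 (t : R) k : 0 <= t -> t <= 1 -> `|t *: (s *: basis_vec R k)| <= s.
    move=> t0 t1; rewrite scalerA normrZ ger0_norm ?mulr_ge0 //.
    rewrite -[leRHS]mulr1 ler_pM ?mulr_ge0 ?norm_basis_vec //.
    by rewrite -[leRHS]mul1r ler_wpM2r.
  by rewrite mulr_natl mulr2n lerD // le1.
have dx (p q : R) : 0 <= p <= 1 -> 0 <= q <= 1 ->
    differentiable f (x + p *: (s *: ei) + q *: (s *: ej)).
  by move=> p01 q01; apply: (smooth_differentiable sf); apply: xU; exact: near_x.
have l01 : 0 <= (1 : R) <= 1 by rewrite ler01 lexx.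
have l00 : 0 <= (0 : R) <= 1 by rewrite ler01 lexx.
have D (t : R) : 0 <= t <= 1 -> is_derive t 1
   (fun t : R => f (x + s *: ej + t *: (s *: ei)) - f (x + t *: (s *: ei)))
   ('D_(s *: ei) f (x + s *: ej + t *: (s *: ei)) -
    'D_(s *: ei) f (x + t *: (s *: ei))).
  move=> t01; apply: is_deriveB; apply: is_derive_line.
    by have := dx t 1 t01 l01; rewrite scale1r addrAC.
  by have := dx t 0 t01 l00; rewrite scale0r addr0.
have [t| |p] := @MVT_segment R
   (fun t : R => f (x + s *: ej + t *: (s *: ei)) - f (x + t *: (s *: ei)))
   (fun t => 'D_(s *: ei) f (x + s *: ej + t *: (s *: ei)) -
             'D_(s *: ei) f (x + t *: (s *: ei))) 0 1 ler01.
- by rewrite in_itv /= => /andP[/ltW t0 /ltW t1]; apply: D; rewrite t0.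
- apply: derivable_within_continuous => t; rewrite in_itv /= => t01.
  by have [] := D t t01.
rewrite in_itv /= => p01.
rewrite !scale1r !scale0r !addr0 subr0 mulr1 => ->.
have dfi y : `|y - x| <= 2 * s -> differentiable ('D_ei f) y.
  by move=> /xU; exact: smooth_differentiable (smooth_derive i sf).
have [q q01] : exists2 q : R, 0 <= q <= 1 &
    'D_ei f (x + p *: (s *: ei) + s *: ej) - 'D_ei f (x + p *: (s *: ei)) =
    'D_(s *: ej) ('D_ei f) (x + p *: (s *: ei) + q *: (s *: ej)).
  by apply: (@MVT_line R ('D_ei f)) => q q01; apply: dfi; exact: near_x.
have Z (g : 'rV[R]_3 -> R) y k : differentiable g y ->
    'D_(s *: basis_vec R k) g y = s * 'D_(basis_vec R k) g y.
  exact: derive_dirZ.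
rewrite Z => [E|]; last by apply: dfi; exact: near_x.
exists (x + p *: (s *: ei) + q *: (s *: ej)); first exact: near_x.
have := dx p 1 p01 l01; rewrite scale1r => d1.
have := dx p 0 p01 l00; rewrite scale0r addr0 => d0.
by rewrite -E addrAC !Z // mulrBr.
Qed.

(** The second difference is symmetric in [i] and [j], so the two mixed derivatives take a common
    value at points arbitrarily close to [x]; continuity brings this back to [x]. *)
Lemma schwarz U (f : 'rV[R]_3 -> R) x i j : open U -> smooth U f -> U x ->
  'D_(basis_vec R i) ('D_(basis_vec R j) f) x =
  'D_(basis_vec R j) ('D_(basis_vec R i) f) x.
Proof.
move=> oU sf Ux; apply/eqP; rewrite -subr_eq0 -normr_le0; apply/ler_addgt0Pl => e e0.
rewrite addr0.
have near_D k l : exists2 d : R, 0 < d & forall y, `|y - x| < d ->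
    `|'D_(basis_vec R k) ('D_(basis_vec R l) f) x -
      'D_(basis_vec R k) ('D_(basis_vec R l) f) y| <= e / 2.
  have c := smooth_continuous (smooth_derive k (smooth_derive l sf)) Ux.
  have e20 : 0 < e / 2 by rewrite divr_gt0.
  have /(@cvgrPdist_le _ _ _ (nbhs x))/(_ _ e20) := c.
  move=> /nbhs_ballP[d /= d0 dE]; exists d => // y yd; apply: dE.
  by rewrite -ball_normE /= distrC.
have [d1 d10 D1] := near_D i j; have [d2 d20 D2] := near_D j i.
have [d3 d30 D3] := nbhs_norm_le (open_nbhs_nbhs (conj oU Ux)).
(* Dividing by 3 makes [2 * s] strictly smaller than all three radii. *)
pose s := Num.min d1 (Num.min d2 d3) / 3.
have m0 : 0 < Num.min d1 (Num.min d2 d3) by rewrite !lt_min d10 d20.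
have s0 : 0 < s by rewrite divr_gt0.
have s2 : 2 * s < Num.min d1 (Num.min d2 d3) by rewrite /s; lra.
move: s2; rewrite !lt_min => /and3P[s1 s2 s3].
have sU y : `|y - x| <= 2 * s -> U y by move=> ys; apply: D3; exact: le_trans (ltW s3).
have [y yx Ey] := second_difference i j sf (ltW s0) sU.
have [z zx Ez] := second_difference j i sf (ltW s0) sU.
have E : 'D_(basis_vec R j) ('D_(basis_vec R i) f) y =
         'D_(basis_vec R i) ('D_(basis_vec R j) f) z.
  suff /(mulfI (lt0r_neq0 s0))/(mulfI (lt0r_neq0 s0)) :
    s * (s * 'D_(basis_vec R j) ('D_(basis_vec R i) f) y) =
    s * (s * 'D_(basis_vec R i) ('D_(basis_vec R j) f) z) by [].
  apply: etrans (esym Ey) (etrans _ Ez).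
  rewrite (addrAC x (s *: basis_vec R i)).
  move: (f _) (f (x + _)) (f (x + _)) (f x) => p q r t.
  ring.
have A := D1 z (le_lt_trans zx s1).
have B : `|'D_(basis_vec R j) ('D_(basis_vec R i) f) x -
           'D_(basis_vec R i) ('D_(basis_vec R j) f) z| <= e / 2.
  exact: (eq_ind _ (fun w => `|_ - w| <= e / 2) (D2 y (le_lt_trans yx s2)) _ E).
apply: le_trans (ler_distD _ _ _) _; rewrite [e]splitr.
by apply: lerD A _; rewrite distrC.
Qed.

End Schwarz.

(** * Integrals depending on a parameter *)

Section UnitIntegral.
Variable R : realType.
Implicit Types f g : R -> R.

Definition unit_integral f : R := \int[@lebesgue_measure R]_(t in `[0, 1]) f t.

Definition unit_integrable f :=
  (@lebesgue_measure R).-integrable `[0%R, 1%R] (EFin \o f).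

Lemma unit_integrable_continuous f :
  (forall t, 0 <= t <= 1 -> {for t, continuous f}) -> unit_integrable f.
Proof.
move=> cf; apply: continuous_compact_integrable; first exact: segment_compact.
apply: continuous_in_subspaceT => t; rewrite inE /= in_itv /=; exact: cf.
Qed.

Lemma unit_integrableD f g : unit_integrable f -> unit_integrable g ->
  unit_integrable (fun t => f t + g t).
Proof. by move=> fi gi; exact: (integrableD _ fi gi). Qed.

Lemma unit_integrableZ c f : unit_integrable f -> unit_integrable (fun t => c * f t).
Proof. by move=> fi; exact: (integrableZl _ c fi). Qed.

Lemma unit_integralD f g : unit_integrable f -> unit_integrable g ->
  unit_integral (fun t => f t + g t) = unit_integral f + unit_integral g.
Proof. by move=> fi gi; exact: (RintegralD _ fi gi). Qed.

Lemma unit_integralZ c f : unit_integrable f ->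
  unit_integral (fun t => c * f t) = c * unit_integral f.
Proof. by move=> fi; exact: (RintegralZl _ _ fi). Qed.

Lemma eq_unit_integral f g : (forall t, 0 <= t <= 1 -> f t = g t) ->
  unit_integral f = unit_integral g.
Proof. by move=> fg; apply: eq_Rintegral => t; rewrite inE /= in_itv /=; exact: fg. Qed.

Lemma unit_integrableN f :
  unit_integrable f -> unit_integrable (fun t => - f t).
Proof.
move=> fi; rewrite (_ : (fun t => _) = fun t => -1 * f t).
  exact: unit_integrableZ.
by apply/funext => t; rewrite mulN1r.
Qed.

Lemma unit_integralN f : unit_integrable f ->
  unit_integral (fun t => - f t) = - unit_integral f.
Proof.
move=> fi; rewrite -mulN1r -unit_integralZ //.
by apply: eq_unit_integral => t _; rewrite mulN1r.
Qed.

Lemma unit_integrable_sum n (f : 'I_n -> R -> R) :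
  (forall i, unit_integrable (f i)) -> unit_integrable (fun t => \sum_i f i t).
Proof.
elim: n f => [|n IH] f fi.
  rewrite (_ : (fun t => _) = fun=> 0); last by apply/funext => t; rewrite big_ord0.
  by apply: unit_integrable_continuous => t _; exact: cst_continuous.
rewrite (_ : (fun t => _) = fun t => f ord0 t + \sum_i f (lift ord0 i) t); last first.
  by apply/funext => t; rewrite big_ord_recl.
by apply: unit_integrableD; [|apply: IH].
Qed.

Lemma unit_integral_sum n (f : 'I_n -> R -> R) :
  (forall i, unit_integrable (f i)) ->
  unit_integral (fun t => \sum_i f i t) = \sum_i unit_integral (f i).
Proof.
elim: n f => [|n IH] f fi.
  (* Zero is written as a product with 0 so that [unit_integralZ] evaluates the integral of the
     empty sum. *)
  rewrite big_ord0 (_ : (fun t => _) = fun=> 0 * 0); last first.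
    by apply/funext => t; rewrite big_ord0 mul0r.
  rewrite unit_integralZ ?mul0r //.
  by apply: unit_integrable_continuous => t _; exact: cst_continuous.
rewrite big_ord_recl -IH // -unit_integralD //; last by apply: unit_integrable_sum.
by apply: eq_unit_integral => t _; rewrite big_ord_recl.
Qed.

Lemma unit_integral_le f (C : R) : unit_integrable f ->
  (forall t, 0 <= t <= 1 -> `|f t| <= C) -> `|unit_integral f| <= C.
Proof.
move=> fi fC; have ci : unit_integrable (fun=> C).
  by apply: unit_integrable_continuous => t _; exact: cst_continuous.
apply: le_trans (le_normr_Rintegral _ fi) _ => //.
have -> : C = \int[@lebesgue_measure R]_(t in `[0, 1]) C.
  have E : lebesgue_measure (`[0%R, 1%R]%classic : set R) = 1%E.
    by rewrite lebesgue_measure_itv /= lte_fin ltr01 sube0.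
  rewrite Rintegral_cst //; apply: esym.
  by transitivity (C * fine 1%E); [congr (_ * fine _); exact: E|rewrite mulr1].
apply: le_Rintegral => //.
  exact: (integrable_norm fi).
Qed.

Lemma unit_integral_derive f (F : R -> R) :
  (forall t : R, 0 <= t <= 1 -> {for t, continuous f}) ->
  (forall t : R, 0 <= t <= 1 -> is_derive t 1 F (f t)) ->
  unit_integral f = F 1 - F 0.
Proof.
move=> cf dF; rewrite /unit_integral /Rintegral.
rewrite (@continuous_FTC2 _ f F 0 1) //.
- by apply: continuous_in_subspaceT => t; rewrite inE /= in_itv /=; exact: cf.
- have cF t : 0 <= t <= 1 -> {for t, continuous F}.
    move=> t01; apply: differentiable_continuous; apply/derivable1_diffP.
    by have [] := dF t t01.
  split=> [t| |].
  + rewrite in_itv /= => /andP[/ltW t0 /ltW t1].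
    by have [] := dF t (introT andP (conj t0 t1)).
  + by apply: cvg_at_right_filter; apply: cF; rewrite lexx ler01.
  + by apply: cvg_at_left_filter; apply: cF; rewrite lexx ler01.
- move=> t; rewrite in_itv /= => /andP[/ltW t0 /ltW t1].
  by rewrite derive1E; have [_ ->] := dF t (introT andP (conj t0 t1)).
Qed.

End UnitIntegral.

(** * Integrals along a scaling and differentiation under the integral sign *)

Section ParametrisedIntegral.
Variable R : realType.
Implicit Types (x y v a : 'rV[R]_3) (U : set 'rV[R]_3) (P : pred 'I_3).

Definition coord_proj P v : 'rV[R]_3 := \row_j (if P j then v 0 j else 0).

(** The homothety of centre [a] and ratio [t] in the coordinates selected by [P], the identity in
    the others. In this form it is visibly a line in [t] with direction [coord_proj P (y - a)], as
    [is_derive_line] expects. *)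
Definition scaling a P (t : R) y :=
  y - coord_proj P (y - a) + t *: coord_proj P (y - a).

Lemma scalingE a P t y j :
  scaling a P t y 0 j = if P j then a 0 j + t * (y 0 j - a 0 j) else y 0 j.
Proof. by rewrite !mxE; case: ifP => _; ring. Qed.

Lemma scaling1 a P y : scaling a P 1 y = y.
Proof. by rewrite /scaling scale1r subrK. Qed.

Lemma scaling_ball a P (r t : R) y : 0 <= t <= 1 -> `|y - a| <= r ->
  `|scaling a P t y - a| <= r.
Proof.
move=> /andP[t0 t1] yr; apply: rV_norm_le => [|j]; first exact: le_trans yr.
rewrite [X in `|X|]mxE scalingE [X in _ + X]mxE; apply: le_trans yr.
apply: le_trans (coord_le_norm _ j).
rewrite [X in _ <= `|X|]mxE [X in _ <= `|_ + X|]mxE.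
case: ifP => // _; rewrite addrC addKr normrM ger0_norm //.
by rewrite -[leRHS]mul1r ler_wpM2r.
Qed.

(** The weight [t ^+ m] closes the family under differentiation: differentiating along a scaled
    coordinate brings out one more factor [t]. *)
Definition scaling_integral a P m (h : 'rV[R]_3 -> R) y : R :=
  unit_integral (fun t => t ^+ m * h (scaling a P t y)).

Lemma scaling_integrand_continuous a P m (h : 'rV[R]_3 -> R) y (t : R) :
  {for scaling a P t y, continuous h} ->
  {for t, continuous (fun s : R => s ^+ m * h (scaling a P s y))}.
Proof.
move=> ch; apply: continuousM; first exact: exprn_continuous.
apply: (@continuous_comp _ _ _ (fun s : R => scaling a P s y) h t _ ch).
apply: differentiable_continuous.
by apply: differentiableD => //; apply: differentiableZl.
Qed.

Section Ball.
Variables (a : 'rV[R]_3) (r : R) (U : set 'rV[R]_3).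
Hypotheses (r0 : 0 < r) (oU : open U) (rU : forall y, `|y - a| <= r -> U y).

Lemma smooth_ball_bounded (h : 'rV[R]_3 -> R) : smooth U h ->
  exists M : R, forall y, `|y - a| <= r -> `|h y| <= M.
Proof.
move=> sh.
have cK := @compact_norm_ball R a r r0.
have [| |c _ cM] := @EVT_max_rV R 3 (fun y => `|h y|) _ _ cK.
- by exists a; rewrite /= subrr normr0 ltW.
- apply: continuous_in_subspaceT => y; rewrite inE => /rU Uy.
  exact: (@continuous_comp _ _ _ h Num.norm y (smooth_continuous sh Uy)
    (@norm_continuous _ _ (h y))).
by exists `|h c| => y ya; apply: cM; rewrite inE.
Qed.

Lemma scaling_integrable P m (h : 'rV[R]_3 -> R) y : smooth U h -> `|y - a| <= r ->
  unit_integrable (fun t => t ^+ m * h (scaling a P t y)).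
Proof.
move=> sh ya; apply: unit_integrable_continuous => t t01.
apply: scaling_integrand_continuous; apply: (smooth_continuous sh).
by apply: rU; exact: scaling_ball.
Qed.

(** One constant serves the whole ball. Under the integral sign the base point moves with [t], so a
    remainder estimate at a single point would not do. *)
Lemma taylor1_ball (h : 'rV[R]_3 -> R) : smooth U h -> exists2 C : R, 0 <= C &
  forall y v, `|y - a| <= r -> `|y + v - a| <= r ->
    `|h (y + v) - h y - \sum_j v 0 j * 'D_(basis_vec R j) h y| <= C * `|v| ^+ 2.
Proof.
move=> sh.
have [M MP] : exists M : R, forall i j y, `|y - a| <= r ->
    `|'D_(basis_vec R i) ('D_(basis_vec R j) h) y| <= M.
  have bd ij := cid (smooth_ball_bounded (smooth_derive ij.1 (smooth_derive ij.2 sh))).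
  exists (\sum_ij `|projT1 (bd ij)|) => i j y ya.
  rewrite (bigD1 (i, j)) //= ler_wpDr ?sumr_ge0 // (le_trans _ (ler_norm _)) //.
  exact: (projT2 (bd (i, j))).
have M0 : 0 <= M by rewrite (le_trans (normr_ge0 _) (MP 0 0 a _)) // subrr normr0 ltW.
(* One factor 3 comes from summing over the coordinates of [v], the other from the Lipschitz
   constant [3 * M] of the first derivatives. *)
exists (9 * M) => [|y v ya yva]; first by rewrite mulr_ge0.
have dh z : `|z - a| <= r -> differentiable h z.
  by move=> za; apply: (smooth_differentiable sh); exact: rU.
have [t t01 ->] : exists2 t : R, 0 <= t <= 1 & h (y + v) - h y = 'D_v h (y + t *: v).
  by apply: MVT_line => t t01; apply: dh; exact: ball_segment.
have yta := ball_segment t01 ya yva.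
rewrite derive_basis_sum; last exact: dh.
rewrite -sumrB; apply: le_trans (ler_norm_sum _ _ _) _.
have -> : 9 * M * `|v| ^+ 2 = \sum_(j < 3) `|v| * (3 * M * `|v|).
  by rewrite sumr_const card_ord -mulr_natl; ring.
apply: ler_sum => j _; rewrite -mulrBr normrM ler_pM //; first exact: coord_le_norm.
apply: le_trans (_ : 3 * M * `|y + t *: v - y| <= _).
  apply: (@lipschitz_ball R ('D_(basis_vec R j) h) a r M _ _ _ _ yta ya)
    => [z za|z i za].
    exact: (smooth_differentiable (smooth_derive j sh) (rU za)).
  exact: MP.
rewrite addrC addKr normrZ ler_wpM2l ?mulr_ge0 //.
by case/andP: t01 => t0 t1; rewrite ger0_norm // -[leRHS]mul1r ler_wpM2r.
Qed.

(** The first-order remainder of the integrand is bounded by a multiple of [|v| ^+ 2] uniformly in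
    [t], and integration keeps this bound. In the exponent, the boolean [P i] counts as 1 exactly in
    the scaled directions. *)
Lemma scaling_integral_derive P m (h : 'rV[R]_3 -> R) y : smooth U h -> `|y - a| < r ->
  differentiable (scaling_integral a P m h) y /\
  forall i, 'D_(basis_vec R i) (scaling_integral a P m h) y =
    scaling_integral a P (P i + m) ('D_(basis_vec R i) h) y.
Proof.
move=> sh ya; apply: differentiable_frechet => e e0.
have [C C0 HC] := taylor1_ball sh.
(* The first bound keeps [v + y] in the ball, the second turns [C * |v|^2] into at most [e * |v|];
   adding 1 to [C] avoids a zero denominator. *)
have d0 : 0 < Num.min (r - `|y - a|) (e / (C + 1)).
  by rewrite lt_min subr_gt0 ya divr_gt0 // ltr_wpDl.
apply: filterS (nbhs0_lt d0) => v; rewrite lt_min => /andP[vr ve].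
have yva : `|v + y - a| <= r.
  rewrite -addrA (le_trans (ler_normD _ _)) //.
  by rewrite -lerBrDr ltW.
have ya' := ltW ya.
have int k g z : smooth U g -> `|z - a| <= r ->
   unit_integrable (fun t => t ^+ k * g (scaling a P t z)).
  exact: scaling_integrable.
have iS : unit_integrable (fun t => \sum_j v 0 j *
    (t ^+ (P j + m) * 'D_(basis_vec R j) h (scaling a P t y))).
  apply: unit_integrable_sum => j; apply: unit_integrableZ.
  exact: (int _ _ _ (smooth_derive j sh) ya').
have iA := int m h _ sh yva; have iB := unit_integrableN (int m h _ sh ya').
have -> : scaling_integral a P m h (v + y) - scaling_integral a P m h y -
    \sum_j v 0 j *: scaling_integral a P (P j + m) ('D_(basis_vec R j) h) y =
  unit_integral (fun t => t ^+ m * h (scaling a P t (v + y)) +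
    - (t ^+ m * h (scaling a P t y)) + - \sum_j v 0 j *
    (t ^+ (P j + m) * 'D_(basis_vec R j) h (scaling a P t y))).
  rewrite (unit_integralD (unit_integrableD iA iB) (unit_integrableN iS)).
  rewrite (unit_integralD iA iB) (unit_integralN (int m h _ sh ya')).
  rewrite (unit_integralN iS).
  congr (_ - _ - _); rewrite unit_integral_sum => [|j]; last first.
    by apply: unit_integrableZ; exact: (int _ _ _ (smooth_derive j sh) ya').
  apply: eq_bigr => j _; rewrite unit_integralZ //.
  exact: (int _ _ _ (smooth_derive j sh) ya').
apply: le_trans (_ : C * `|v| ^+ 2 <= _); last first.
  rewrite expr2 mulrA ler_wpM2r //.
  have : C * `|v| <= (C + 1) * (e / (C + 1)).
    by apply: ler_pM => //; [rewrite lerDl|exact: ltW].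
  by rewrite mulrCA divff ?mulr1 // gt_eqF // ltr_wpDl.
apply: unit_integral_le => [|t t01].
  apply: unit_integrableD; last exact: unit_integrableN.
  exact: unit_integrableD.
(* The displacement of the scaled point when [y] moves by [v]: scaled coordinates shrink by [t], so
   [w] is no longer than [v]. *)
pose w := scaling a P t (v + y) - scaling a P t y.
have wE j : w 0 j = t ^+ P j * v 0 j.
  rewrite [LHS]mxE [X in _ + X]mxE !scalingE !mxE.
  by case: (P j) => /=; rewrite ?expr0 ?expr1; ring.
have wv : `|w| <= `|v|.
  apply: rV_norm_le => // j; rewrite wE normrM.
  apply: le_trans (coord_le_norm v j); rewrite -[leRHS]mul1r ler_wpM2r //.
  by case/andP: t01 => t0 t1; rewrite ger0_norm ?exprn_ge0 // exprn_ile1.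
have -> : t ^+ m * h (scaling a P t (v + y)) - t ^+ m * h (scaling a P t y) -
    \sum_j v 0 j * (t ^+ (P j + m) * 'D_(basis_vec R j) h (scaling a P t y)) =
  t ^+ m * (h (scaling a P t y + w) - h (scaling a P t y) -
    \sum_j w 0 j * 'D_(basis_vec R j) h (scaling a P t y)).
  rewrite [_ + w]addrC subrK !mulrBr mulr_sumr; congr (_ - _ - _).
  by apply: eq_bigr => j _; rewrite wE exprD; ring.
rewrite normrM; apply: le_trans (_ : 1 * (C * `|w| ^+ 2) <= _).
  apply: ler_pM => //.
    by case/andP: t01 => t0 t1; rewrite ger0_norm ?exprn_ge0 // exprn_ile1.
  apply: HC; first exact: scaling_ball.
  by rewrite [_ + w]addrC subrK; exact: scaling_ball.
by rewrite mul1r ler_wpM2l // lerXn2r ?nnegrE.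
Qed.

Lemma scaling_integral_smooth P m (h : 'rV[R]_3 -> R) : smooth U h ->
  smooth [set y | `|y - a| < r] (scaling_integral a P m h).
Proof.
move=> sh k; elim: k m h sh => [|k IH] m h sh.
  move=> y ya; apply: differentiable_continuous.
  by have [] := scaling_integral_derive P m sh ya.
split=> [y ya|i]; first by have [] := scaling_integral_derive P m sh ya.
apply: eq_Ck (IH (P i + m)%N _ (smooth_derive i sh)) => [|y].
  exact: open_norm_ball.
by rewrite inE => ya; have [_ ->] := scaling_integral_derive P m sh ya.
Qed.

(** With v the selected part of y - a, the derivative in t of t * h(scaling t y) is h + t * D_v h at
    the scaled point. Integrating from 0 to 1 leaves only the value at t = 1, which is h y. *)
Lemma scaling_integral_radial P (h : 'rV[R]_3 -> R) y : smooth U h -> `|y - a| < r ->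
  scaling_integral a P 0 h y + \sum_(j | P j) (y 0 j - a 0 j) *
     scaling_integral a P 1 ('D_(basis_vec R j) h) y = h y.
Proof.
move=> sh /ltW ya.
have dh t : 0 <= t <= 1 -> differentiable h (scaling a P t y).
  move=> t01; apply: (smooth_differentiable sh).
  by apply: rU; exact: scaling_ball.
transitivity (unit_integral (fun t => t ^+ 0 * h (scaling a P t y) +
   \sum_j (coord_proj P (y - a)) 0 j *
     (t ^+ 1 * 'D_(basis_vec R j) h (scaling a P t y)))).
  have int m g : smooth U g -> unit_integrable (fun t => t ^+ m * g (scaling a P t y)).
    by move=> sg; exact: scaling_integrable.
  have ij j := unit_integrableZ (coord_proj P (y - a) 0 j)
    (int 1%N _ (smooth_derive j sh)).
  rewrite unit_integralD; [|exact: int|exact: unit_integrable_sum].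
  congr (_ + _); rewrite unit_integral_sum // big_mkcond; apply: eq_bigr => j _.
  rewrite unit_integralZ; last exact: (int _ _ (smooth_derive j sh)).
  by rewrite !mxE; case: (P j); rewrite ?mul0r.
set v := coord_proj P (y - a).
pose F (t : R) := t * h (scaling a P t y).
transitivity (unit_integral (fun t => t ^+ 0 * h (scaling a P t y) +
    t ^+ 1 * 'D_v h (scaling a P t y))).
  apply: eq_unit_integral => t t01; congr (_ + _).
  rewrite (derive_basis_sum v (dh t t01)) mulr_sumr.
  by apply: eq_bigr => j _; rewrite mulrCA.
transitivity (F 1 - F 0); last by rewrite /F mul0r subr0 mul1r scaling1.
apply: unit_integral_derive => t t01.
- have Us : U (scaling a P t y) by apply: rU; exact: scaling_ball.
  have c0 := @scaling_integrand_continuous a P 0 h y t (smooth_continuous sh Us).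
  have c1 := @scaling_integrand_continuous a P 1 ('D_v h) y t
    (smooth_continuous (smooth_derive_dir v oU sh) Us).
  exact: (continuousD c0 c1).
- have D := is_deriveM (is_derive_id t 1) (is_derive_line (dh t t01)).
  apply: (@is_derive_eq _ _ _ F t 1 _ _ D).
  by rewrite expr0 expr1 mul1r addrC; congr (_ + _); rewrite [LHS]mulr1.
Qed.

End Ball.
End ParametrisedIntegral.

(** * The Poincare lemma *)

Section Primitive.
Variable R : realType.

(* A form closed in the directions of P is exact in these directions, uniformly
   in the others; P = predT is the Poincare lemma, P = pred1 i gives an
   antiderivative with respect to the i-th variable. *)
Lemma partial_poincare (P : pred 'I_3) (U : set 'rV[R]_3) (a : 'rV[R]_3) (r : R)
    (w : 'I_3 -> 'rV[R]_3 -> R) :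
  0 < r -> open U -> (forall y, `|y - a| <= r -> U y) ->
  (forall j, smooth U (w j)) ->
  (forall i j y, P i -> P j -> U y ->
     'D_(basis_vec R i) (w j) y = 'D_(basis_vec R j) (w i) y) ->
  exists f : 'rV[R]_3 -> R, smooth [set y | `|y - a| < r] f /\
    forall i y, P i -> `|y - a| < r -> 'D_(basis_vec R i) f y = w i y.
Proof.
move=> r0 oU rU sw cw; have oN := @open_norm_ball R a r.
(* The radial homotopy formula: the form is integrated along the segment from the point with the [P]
   coordinates of [a] to [y]. *)
pose g j (y : 'rV[R]_3) : R := (y 0 j - a 0 j) * scaling_integral a P 0 (w j) y.
have sg j : smooth [set y | `|y - a| < r] (g j).
  move=> k; apply: CkM => //; last exact: (scaling_integral_smooth r0 rU _ _ (sw j)).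
  by apply: CkB => //; [exact: Ck_coord|exact: Ck_cst].
exists (fun y => \sum_(j | P j) g j y); split=> [k|i y Pi ya].
  by apply: Ck_sum => // j _; exact: sg.
have -> : (fun y => \sum_(j | P j) g j y) = \sum_j (fun y => if P j then g j y else 0).
  by apply/funext => z; rewrite fct_sumE big_mkcond.
rewrite derive_sum => [|j]; last first.
  case: (P j); last exact: derivable_cst.
  by apply: diff_derivable; exact: (smooth_differentiable (sg j)).
(* Expanding [w i] radially produces the same terms as differentiating the sum of the [g j], once
   closedness has exchanged the indices. *)
rewrite -[RHS](scaling_integral_radial oU rU P (sw i) ya).
have D j : P j -> 'D_(basis_vec R i) (g j) y =
    (j == i)%:R * scaling_integral a P 0 (w j) y +
    (y 0 j - a 0 j) * scaling_integral a P 1 ('D_(basis_vec R j) (w i)) y.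
  move=> Pj.
  have [dI DI] := scaling_integral_derive r0 rU P 0 (sw j) ya.
  have dc : differentiable (fun y : 'rV[R]_3 => y 0 j - a 0 j) y.
    by apply: differentiableB => //; exact: differentiable_coord.
  have Dc : 'D_(basis_vec R i) (fun y : 'rV[R]_3 => y 0 j - a 0 j) y = (j == i)%:R.
    rewrite -[fun y => _ - _]/((fun y : 'rV[R]_3 => y 0 j) - cst (a 0 j)) deriveB.
      by rewrite derive_cst subr0 derive_coordinate basis_vecE.
      by apply: diff_derivable; exact: differentiable_coord.
    exact: derivable_cst.
  (* Closedness is used under the integral, at scaled points, which remain in [U]. *)
  have DIj : 'D_(basis_vec R i) (scaling_integral a P 0 (w j)) y =
      scaling_integral a P 1 ('D_(basis_vec R j) (w i)) y.
    rewrite DI Pi; apply: eq_unit_integral => t t01.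
    have Us : U (scaling a P t y).
      by apply: rU; apply: scaling_ball t01 _; exact: ltW.
    exact: (congr1 ( *%R (t ^+ 1)) (cw i j _ Pi Pj Us)).
  rewrite /g -[fun y => _ * _]/((fun y : 'rV[R]_3 => y 0 j - a 0 j) *
    scaling_integral a P 0 (w j)).
  rewrite deriveM; [|exact: diff_derivable|exact: diff_derivable].
  by rewrite Dc DIj addrC [X in X + _]mulrC.
rewrite (bigD1 i) //= Pi D // eqxx mul1r -addrA; congr (_ + _).
rewrite [RHS](bigD1 i) //=; congr (_ + _).
rewrite [RHS]big_mkcondl; apply: eq_bigr => j ji.
case: ifP => Pj; last exact: derive_cst.
by rewrite D // (negbTE ji) mul0r add0r.
Qed.

End Primitive.

(** * The inverse function theorem *)

Section InverseFunction.
Variable R : realType.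
Implicit Types (x y v : 'rV[R]_3) (U V : set 'rV[R]_3).

(** The partial derivatives are rows, the transpose of the usual convention: vectors are rows and
    act from the left, so the chain rule multiplies the inner Jacobian first. *)
Definition jac (f : 'rV[R]_3 -> 'rV[R]_3) x : 'M[R]_3 :=
  \matrix_i 'D_(basis_vec R i) f x.

Lemma derive_jac f x v : differentiable f x -> 'D_v f x = v *m jac f x.
Proof.
move=> df; rewrite derive_basis_sum // mulmx_sum_row.
by apply: eq_bigr => j _; rewrite rowK.
Qed.

Lemma jac_comp f g x : differentiable g x -> differentiable f (g x) ->
  jac (fun y => f (g y)) x = jac g x *m jac f (g x).
Proof.
move=> dg df; apply/row_matrixP => i.
by rewrite rowK row_mul rowK derive_comp // derive_jac.
Qed.

Lemma jacE f x i j : differentiable f x ->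
  jac f x i j = 'D_(basis_vec R i) (fun y => f y 0 j) x.
Proof. by move=> df; rewrite mxE derive_coord. Qed.

Lemma jac_id x : jac id x = 1%:M.
Proof. by apply/row_matrixP => i; rewrite rowK derive_id row1. Qed.

Lemma Ck_jac k U f i j : open U -> smooth U f -> Ck k U (fun x => jac f x i j).
Proof.
move=> oU sf; have /Ck_rV := smooth_derive i sf k => /(_ oU j).
by apply: eq_Ck => // x _; rewrite mxE.
Qed.

Lemma mulmx_norm_le (M : 'M[R]_3) :
  exists2 C : R, 0 < C & forall v, `|v *m M| <= C * `|v|.
Proof.
exists (1 + \sum_ij `|M ij.1 ij.2|) => [|v].
  by rewrite ltr_pwDl // sumr_ge0.
apply: rV_norm_le => [|j]; first by rewrite mulr_ge0 // addr_ge0 // sumr_ge0.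
rewrite mxE (le_trans (ler_norm_sum _ _ _)) //.
apply: le_trans (_ : \sum_k `|M k j| * `|v| <= _).
  by apply: ler_sum => k _; rewrite normrM mulrC ler_wpM2l // coord_le_norm.
rewrite -mulr_suml ler_wpM2r // ler_wpDl //.
rewrite -(pair_bigA _ (fun i j => `|M i j|)) /=.
by apply: ler_sum => k _; rewrite (bigD1 j) //= lerDl sumr_ge0.
Qed.

(* That is, x - f x * (jac f p)^-1 is a contraction near p. *)
Lemma local_contraction U f p : open U -> smooth U f -> U p -> jac f p \in unitmx ->
  exists2 r : R, 0 < r & (forall x, `|x - p| <= r -> U x /\ jac f x \in unitmx) /\
    forall x y, `|x - p| <= r -> `|y - p| <= r ->
      `|(x - y) - (f x - f y) *m invmx (jac f p)| <= `|x - y| / 2.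
Proof.
move=> oU sf Up Ju; set B := invmx _.
(* The components of x - f x *m B. Their derivatives vanish at [p] because [B] inverts [jac f p],
   and being scalar they fall under the mean value bound [lipschitz_ball]. *)
pose T j x := x 0 j - \sum_k f x 0 k * B k j.
have sT j : smooth U (T j).
  move=> k; apply: CkB => //; first exact: Ck_coord.
  apply: Ck_sum => // i _; apply: CkM => //; last exact: Ck_cst.
  by have /Ck_rV := sf k; apply.
have TE x y j : ((x - y) - (f x - f y) *m B) 0 j = T j x - T j y.
  rewrite /T mulmxBl !mxE; ring.
have DT i j : 'D_(basis_vec R i) (T j) p = 0.
  have df := smooth_differentiable sf Up.
  have dfk k : derivable (fun x => f x 0 k) p (basis_vec R i).
    by apply: diff_derivable; exact: (differentiable_rV f p).1.
  pose S : 'rV[R]_3 -> R := \sum_k (fun x => f x 0 k * B k j).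
  have dS k : derivable (fun x => f x 0 k * B k j) p (basis_vec R i).
    by apply: derivableM => //; exact: derivable_cst.
  have -> : T j = (fun x : 'rV[R]_3 => x 0 j) - S.
    by apply/funext => x; rewrite /T /S !fctE fct_sumE.
  rewrite deriveB; last exact: derivable_sum.
    rewrite derive_coordinate basis_vecE derive_sum //.
    have := mulmxV Ju => /matrixP /(_ i j); rewrite !mxE eq_sym => <-.
    apply/eqP; rewrite subr_eq0; apply/eqP; apply: eq_bigr => k _.
    rewrite -[fun x => _ * _]/((fun x => f x 0 k) * cst (B k j)) deriveM //.
      by rewrite derive_cst scaler0 add0r jacE // mulrC.
  by apply: diff_derivable; exact: differentiable_coord.
have near1 : \forall x \near p, U x /\ jac f x \in unitmx.
  have cd : {for p, continuous (fun x => \det (jac f x))}.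
    have h : Ck 0 U (fun x => \det (jac f x)).
      by apply: Ck_det => // i j; exact: Ck_jac.
    exact: h p Up.
  have d0 : \det (jac f p) != 0 by move: Ju; rewrite unitmxE unitfE.
  have dn := @cvgr_neq0 _ _ _ (nbhs p) _ _ _ cd d0.
  near=> x; split; first by near: x; exact: (open_nbhs_nbhs (conj oU Up)).
  by rewrite unitmxE unitfE; near: x; exact: dn.
(* The bound 1/6 gives each component the Lipschitz constant 3 * (1/6) = 1/2. *)
have near2 i j : \forall x \near p, `|'D_(basis_vec R i) (T j) x| <= 1 / 6.
  have := smooth_continuous (smooth_derive i (sT j)) Up.
  rewrite /prop_for /continuous_at DT => c0.
  by apply: (@cvgr0_norm_le _ _ _ (nbhs p) _ _ c0); rewrite divr_gt0.
have near3 : \forall x \near p, forall ij, `|'D_(basis_vec R ij.1) (T ij.2) x| <= 1 / 6.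
  apply: (@filter_forall _ _
    (fun ij x => `|'D_(basis_vec R ij.1) (T ij.2) x| <= 1 / 6) (nbhs p)) => ij.
  exact: near2.
have [r r0 rP] := nbhs_norm_le (filterI near1 near3).
exists r; [exact: r0|split=> [x xp|x y xp yp]]; first by have [] := rP x xp.
apply: rV_norm_le => [|j]; first by rewrite divr_ge0.
have dT z : `|z - p| <= r -> differentiable (T j) z.
  by move=> /rP[[Uz _] _]; exact: (smooth_differentiable (sT j)).
have MT z i : `|z - p| <= r -> `|'D_(basis_vec R i) (T j) z| <= 1 / 6.
  by move=> /rP[_ /(_ (i, j))].
rewrite TE; apply: le_trans (lipschitz_ball dT MT xp yp) _.
by rewrite le_eqVlt; apply/orP; left; apply/eqP; field.
Unshelve. all: by end_near.
Qed.

End InverseFunction.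

Section InverseFunctionTheorem.
Variable R : realType.
Implicit Types (x y v : 'rV[R]_3) (U V : set 'rV[R]_3).

(* If z is close to f x0, then a minimiser of |(z - f x) B| over a closed ball
   about x0 is a preimage of z: a Newton step from it halves that distance. *)
Lemma local_contraction_open (f : 'rV[R]_3 -> 'rV[R]_3) (B : 'M[R]_3)
    (p : 'rV[R]_3) (r : R) (V' : set 'rV[R]_3) :
  B \in unitmx -> (forall x, `|x - p| <= r -> {for x, continuous f}) ->
  (forall x y, `|x - p| <= r -> `|y - p| <= r ->
    `|(x - y) - (f x - f y) *m B| <= `|x - y| / 2) ->
  open V' -> V' `<=` [set x | `|x - p| < r] -> open (f @` V').
Proof.
move=> Bu cf fB oV' V'r; rewrite openE => _ [x0 V'x0 <-].
have [d d0 dV'] := nbhs_norm_le (open_nbhs_nbhs (conj oV' V'x0)).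
have [C C0 HC] := mulmx_norm_le B.
(* This radius makes (z - f x0) *m B at most d/2; the contraction contributes another d/2, so the
   Newton step [x'] below stays in [K]. *)
apply/nbhs_ballP; exists (d / 2 / C) => /=; first by rewrite !divr_gt0.
move=> z; rewrite ball_mem => zx0.
have {}zx0 : `|(z - f x0) *m B| <= d / 2.
  apply: le_trans (HC _) _; rewrite mulrC -ler_pdivlMr //; exact: ltW.
pose K := [set x | `|x - x0| <= d].
have K_in x : K x -> `|x - p| <= r by move=> /dV' /V'r /ltW.
have cK : compact K by exact: compact_norm_ball.
pose g x := `|(z - f x) *m B|.
have cg : {within K, continuous g}.
  apply: continuous_in_subspaceT => x; rewrite inE => Kx.
  have eC e : 0 < e -> 0 < e / C by move=> e0; rewrite divr_gt0.
  have cfx := cf x (K_in x Kx).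
  apply/(@cvgrPdist_le _ _ _ (nbhs x)) => e e0; near=> y.
  have fxy : `|f x - f y| <= e / C.
    by near: y; have /(@cvgrPdist_le _ _ _ (nbhs x)) h := cfx; exact: (h _ (eC e e0)).
  rewrite /g (le_trans (ler_dist_dist _ _)) // -mulmxBl opprB addrC addrA subrK.
  rewrite -normrN -mulNmx opprB.
  by rewrite (le_trans (HC _)) // mulrC -ler_pdivlMr.
have K0 : K !=set0 by exists x0; rewrite /K /= subrr normr0 ltW.
have [x Kx xmin] := EVT_min_rV K0 cK cg.
rewrite inE in Kx.
exists x; first exact: dV'.
pose x' := x + (z - f x) *m B.
have Kx' : K x'.
  rewrite /K /=; have -> : x' - x0 = (z - f x0) *m B + ((x - x0) - (f x - f x0) *m B).
    by rewrite /x' !mulmxBl; apply/rowP => j; rewrite !mxE; ring.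
  rewrite (le_trans (ler_normD _ _)) // [leRHS](splitr d) lerD //.
  rewrite (le_trans (fB _ _ (K_in _ Kx) _)) //; last by rewrite ler_pM2r.
  by apply: K_in; rewrite /K /= subrr normr0 ltW.
have := fB _ _ (K_in _ Kx') (K_in _ Kx).
have -> : x' - x = (z - f x) *m B by rewrite /x' addrC addKr.
have -> : (z - f x) *m B - (f x' - f x) *m B = (z - f x') *m B.
  by rewrite -mulmxBl; congr (_ *m B); rewrite opprB addrA subrK.
have := xmin x'; rewrite inE => /(_ Kx'); rewrite /g => h1 h2.
have : `|(z - f x) *m B| <= 0 by have := le_trans h1 h2; lra.
rewrite normr_le0 => /eqP zB; apply/eqP; rewrite eq_sym -subr_eq0; apply/eqP.
by rewrite -[LHS](mulmxK Bu) zB mul0mx.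
Unshelve. all: by end_near.
Qed.

(** With u = g (v + f x0) - x0, the remainder of [g] at [v] is minus the remainder of [f] at [u],
    multiplied by the inverse Jacobian matrix. The Lipschitz hypothesis makes [u] of order [v], so
    this is negligible. *)
Lemma inverse_differentiable (f g : 'rV[R]_3 -> 'rV[R]_3) (x0 : 'rV[R]_3) (C : R) :
  differentiable f x0 -> jac f x0 \in unitmx ->
  (\forall z \near f x0, f (g z) = z /\ `|g z - x0| <= C * `|z - f x0|) ->
  g (f x0) = x0 ->
  differentiable g (f x0) /\ jac g (f x0) = invmx (jac f x0).
Proof.
move=> df Ju gP gx0; set J := jac f x0.
have C0 : 0 <= `|C| by [].
suff [dg gE] : differentiable g (f x0) /\
    forall i, 'D_(basis_vec R i) g (f x0) = row i (invmx J).
  by split=> //; apply/row_matrixP => i; rewrite rowK gE.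
apply: differentiable_frechet => e e0.
have [D D0 HD] := mulmx_norm_le (invmx J).
(* Chosen so that the product of [D], [eps] and [|C| + 1] is [e]. *)
pose eps := e / (D * (`|C| + 1)).
have eps0 : 0 < eps by rewrite divr_gt0 // mulr_gt0 // ltr_wpDl.
have /nbhs_ballP[d /= d0 dP] := frechet_remainder df eps0.
have /nbhs_ballP[d' /= d'0 d'P] := gP.
have m0 : 0 < Num.min d' (d / (`|C| + 1)) by rewrite lt_min d'0 divr_gt0 // ltr_wpDl.
apply: filterS (nbhs0_lt m0) => v; rewrite lt_min => /andP[vd' vd].
have [|fgz gzC] := d'P (v + f x0); first by rewrite ball_mem addrK.
rewrite addrK in gzC.
rewrite gx0.
pose u := g (v + f x0) - x0.
have uC : `|u| <= (`|C| + 1) * `|v|.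
  apply: le_trans gzC _; rewrite ler_wpM2r // (le_trans (ler_norm _)) // lerDl.
  exact: ler01.
have du : `|f (u + x0) - f x0 - 'D_u f x0| <= eps * `|u|.
  apply: dP; rewrite ball_mem subr0; apply: le_lt_trans uC _.
  by rewrite mulrC -ltr_pdivlMr // ltr_wpDl.
have -> : \sum_j v 0 j *: row j (invmx J) = v *m invmx J.
  by rewrite mulmx_sum_row.
have -> : g (v + f x0) - x0 - v *m invmx J =
    - (f (u + x0) - f x0 - 'D_u f x0) *m invmx J.
  rewrite derive_jac // {1}/u subrK fgz addrK mulNmx mulmxBl mulmxK // opprB.
  by [].
rewrite mulNmx normrN; apply: le_trans (HD _) _.
apply: le_trans (_ : D * (eps * ((`|C| + 1) * `|v|)) <= _).
  apply: ler_wpM2l; first exact: ltW.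
  by apply: le_trans du _; apply: ler_wpM2l uC; exact: ltW.
rewrite /eps le_eqVlt; apply/orP; left; apply/eqP.
have C1 : `|C| + 1 != 0 by rewrite gt_eqF // ltr_wpDl.
have D1 : D != 0 by rewrite gt_eqF.
by field; rewrite C1 D1.
Qed.

Lemma inverse_function U (f : 'rV[R]_3 -> 'rV[R]_3) p :
  open U -> smooth U f -> U p -> jac f p \in unitmx ->
  exists V g, [/\ open V, V p, V `<=` U & smooth (f @` V) g] /\
    [/\ {in V, cancel f g}, (forall x, V x -> jac f x \in unitmx) &
        forall V', open V' -> V' `<=` V -> open (f @` V')].
Proof.
move=> oU sf Up Ju; have [r r0 [rP fB]] := local_contraction oU sf Up Ju.
set B := invmx _ in fB.
have Bu : B \in unitmx by rewrite unitmx_inv.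
pose V := [set x | `|x - p| < r].
pose g z := xget p [set x | V x /\ f x = z].
have [C C0 HC] := mulmx_norm_le B.
(* [x - y] is the residue bounded by [fB] plus (f x - f y) *m B. The residue absorbs half of
   [|x - y|], hence the factor 2. *)
have lip x y : V x -> V y -> `|x - y| <= 2 * C * `|f x - f y|.
  move=> /ltW Vx /ltW Vy; have := fB x y Vx Vy.
  have := HC (f x - f y).
  have := ler_normD ((x - y) - (f x - f y) *m B) ((f x - f y) *m B).
  rewrite subrK; lra.
have fV : {in V &, injective f}.
  move=> x y; rewrite !inE => Vx Vy fxy; have := lip x y Vx Vy.
  by rewrite fxy subrr normr0 mulr0 normr_le0 subr_eq0 => /eqP.
have gK : {in V, cancel f g}.
  move=> x; rewrite inE => Vx; rewrite /g.
  case: xgetP => [y -> [Vy fyx]|/(_ x)]; last by case.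
  by apply: fV; rewrite ?inE.
have VU x : V x -> U x by move=> /ltW xr; have [] := rP x xr.
have fo V' : open V' -> V' `<=` V -> open (f @` V').
  move=> oV' V'V; apply: (local_contraction_open Bu _ fB) => // x xr.
  by apply: (smooth_continuous sf); have [] := rP x xr.
have oV : open V by exact: open_norm_ball.
have ofV := fo V oV (@subset_refl _ V).
have Vu x : V x -> jac f x \in unitmx by move=> /ltW xr; have [] := rP x xr.
have Vp : V p by rewrite /V /= subrr normr0.
exists V, g; split; last by split; [exact: gK|exact: Vu|exact: fo].
split; [exact: oV|exact: Vp|exact: VU|].
have dg x : V x -> differentiable g (f x) /\ jac g (f x) = invmx (jac f x).
  move=> Vx; apply: (@inverse_differentiable f g x (2 * C)).
  - exact: (smooth_differentiable sf (VU x Vx)).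
  - by have [] := rP x (ltW Vx).
  - have fVx : (f @` V) (f x) by exists x.
    apply: filterS (open_nbhs_nbhs (conj ofV fVx)) => z [y Vy <-].
    by rewrite gK ?inE //; split=> //; exact: lip.
  - by rewrite gK ?inE.
have gV z : (f @` V) z -> V (g z) by move=> [x Vx <-]; rewrite gK ?inE.
(* Bootstrap: the Jacobian of [g] is the inverse of [jac f] taken at [g], so if [g] is of class C^k,
   so are its first derivatives. *)
elim=> [|k IH].
  by move=> _ [x Vx <-]; apply: differentiable_continuous; exact: (dg x Vx).1.
split=> [_ [x Vx <-]|i]; first exact: (dg x Vx).1.
apply/Ck_rV => // j.
have : Ck k (f @` V) (fun z => invmx (jac f (g z)) i j).
  apply: (Ck_invmx ofV) => [z /gV /Vu|i' j']; first exact.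
  have gU z : (f @` V) z -> U (g z) by move=> /gV /VU.
  exact: (Ck_comp ofV oU gU IH (Ck_jac k i' j' oU sf)).
apply: (eq_Ck ofV) => z; rewrite inE => -[x Vx <-].
have := (dg x Vx).2; rewrite gK ?inE // => <-.
by rewrite mxE.
Qed.

End InverseFunctionTheorem.

(** * Adapted charts *)

Section Charts.
Variables (R : realType) (B : body R).
Notation g := (@global_chart R B).

Lemma in_chartE (W : normedModType R) (V : set B) (x : B -> 'rV[R]_3) (f : B -> W) p :
  {in V &, injective x} -> V p -> in_chart V x f (x p) = f p.
Proof.
move=> ix Vp; rewrite /in_chart.
case: xgetP => [_ -> [q [Vq xqp] <-]|/(_ (f p))]; last first.
  by case; exists p.
by congr f; apply: ix; rewrite ?inE.
Qed.

Lemma global_chart_inj : injective g.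
Proof.
by move=> p q; have [_ ig _ _] := global_chartP B; apply: ig; rewrite inE.
Qed.

Lemma in_global_chartE (W : normedModType R) (V : set B) (f : B -> W) p :
  V p -> in_chart V g f (g p) = f p.
Proof. by apply: in_chartE => ? ? _ _; exact: global_chart_inj. Qed.

Lemma open_global_chart (V : set B) : open V -> open (g @` V).
Proof. by have [_ _ _ og] := global_chartP B => oV; apply: og. Qed.

(** The coordinate frame is the Jacobian matrix of the inverse chart, so the chain rule applied to a
    composite equal to the identity near [g q] makes it the inverse of the Jacobian of the chart. *)
Lemma chart_jac (V : set B) (x : B -> 'rV[R]_3) q : local_coordinates V x -> V q ->
  [/\ open (g @` V), differentiable (in_chart V g x) (g q) &
      jac (in_chart V g x) (g q) *m coordinate_frame V x q = 1%:M].
Proof.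
move=> [[oV ix _ ox] sphi spsi] Vq; have ogV := open_global_chart oV.
have gVq : (g @` V) (g q) by exists q.
have dphi := smooth_differentiable sphi gVq.
have phiE p : V p -> in_chart V g x (g p) = x p by exact: in_global_chartE.
have dpsi : differentiable (in_chart V x g) (in_chart V g x (g q)).
  by rewrite phiE //; apply: (smooth_differentiable spsi); exists q.
split=> //.
have := jac_comp dphi dpsi; rewrite phiE // => <-.
rewrite -(jac_id (g q)); apply/row_matrixP => i; rewrite !rowK.
apply: (eq_derive_open _ ogV) => // y; rewrite inE => -[p Vp <-].
by rewrite phiE // in_chartE.
Qed.

Lemma scalar_mulmx (w : {scalar 'rV[R]_3}) (v : 'rV[R]_3) (M : 'M[R]_3) :
  w (v *m M) = \sum_k v 0 k * w (row k M).
Proof.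
by rewrite mulmx_sum_row linear_sum; apply: eq_bigr => k _; rewrite linearZ.
Qed.

Lemma derive_derive_dir (U : set 'rV[R]_3) (f : 'rV[R]_3 -> R) (x u v : 'rV[R]_3) :
  open U -> smooth U f -> U x ->
  'D_u ('D_v f) x = \sum_i \sum_j u 0 i * (v 0 j *
     'D_(basis_vec R i) ('D_(basis_vec R j) f) x).
Proof.
move=> oU sf Ux.
rewrite (derive_basis_sum u (smooth_differentiable (smooth_derive_dir v oU sf) Ux)).
apply: eq_bigr => i _; rewrite -mulr_sumr; congr (_ * _).
have -> : 'D_(basis_vec R i) ('D_v f) x =
    'D_(basis_vec R i) (\sum_j (v 0 j *: 'D_(basis_vec R j) f)) x.
  apply: (eq_derive_open _ oU) => // y; rewrite inE => Uy.
  by rewrite fct_sumE (derive_basis_sum v (smooth_differentiable sf Uy)).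
have dd j : derivable ('D_(basis_vec R j) f) x (basis_vec R i).
  by apply: diff_derivable; exact: (smooth_differentiable (smooth_derive j sf)).
rewrite derive_sum => [|j]; last exact: derivableZ.
by apply: eq_bigr => j _; rewrite deriveZ.
Qed.

Lemma schwarz_dir (U : set 'rV[R]_3) (f : 'rV[R]_3 -> R) (x u v : 'rV[R]_3) :
  open U -> smooth U f -> U x -> 'D_u ('D_v f) x = 'D_v ('D_u f) x.
Proof.
move=> oU sf Ux; rewrite !(derive_derive_dir _ _ oU sf Ux) exchange_big /=.
apply: eq_bigr => i _; apply: eq_bigr => j _.
by rewrite (schwarz j i oU sf Ux) mulrCA.
Qed.

Lemma locally_exact_closed (w : one_form B) (p : B) (U : set 'rV[R]_3)
    (f : 'rV[R]_3 -> R) :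
  open U -> smooth U f -> U (g p) ->
  (forall q v, U (g q) -> w q v = 'D_v f (g q)) ->
  forall u v, ext_derivative w p u v = 0.
Proof.
move=> oU sf Up wf u v.
(* [in_chart] is 0 outside the range of the chart, so the representative of [w] is known to be the
   derivative of [f] only on this intersection. *)
have oO : open (U `&` range g).
  by apply: openI => //; apply: open_global_chart; exact: openT.
have Op : (U `&` range g) (g p) by split=> //; exists p.
have E v' : {in U `&` range g, in_chart setT g (fun q => w q v' : R) =1 'D_v' f}.
  by move=> y; rewrite inE => -[Uy [q _ qy]]; rewrite -qy in_global_chartE // wf // qy.
rewrite /ext_derivative (eq_derive_open _ oO (E v) Op) (eq_derive_open _ oO (E u) Op).
by rewrite (schwarz_dir _ _ oU sf Up) subrr.
Qed.

Lemma integrable_closed (w1 w2 : one_form B) (Om : volume_form B) :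
  integrable_structure (G3C_structure w1 w2 Om) -> closed_form w1 /\ closed_form w2.
Proof.
move=> iP.
suff dual p (w : one_form B) (k : 'I_3) (V : set B) (x : B -> 'rV[R]_3) :
    V p -> local_coordinates V x ->
    (forall q i, V q -> w q (row i (coordinate_frame V x q)) = (i == k)%:R) ->
    forall u v, ext_derivative w p u v = 0.
  split=> p; have [V [x [Vp lx PV]]] := iP p.
    apply: (dual _ _ 1 V x) => // q i Vq; have [_ [e1 e0 e2] _ _] := PV q Vq.
    by elim/ord3_case: i.
  apply: (dual _ _ 2 V x) => // q i Vq; have [_ _ [e2 e0 e1] _] := PV q Vq.
  by elim/ord3_case: i.
move=> Vp lx wE.
have [ogV _ _] := chart_jac lx Vp; have [_ sphi _] := lx.
apply: (@locally_exact_closed w p (g @` V) (fun y => in_chart V g x y 0 k)) => //.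
- by move=> n; have /Ck_rV := sphi n; apply.
move=> q v [q' Vq' gE]; rewrite -(global_chart_inj gE) {q gE}.
have [_ dphi jE] := chart_jac lx Vq'.
rewrite -derive_coord // derive_jac //.
(* The vector [v] is expanded in the coordinate frame; its [k]-th component there is the derivative
   of the [k]-th coordinate along [v]. *)
rewrite -{1}[v]mulmx1 -jE mulmxA scalar_mulmx (bigD1 k) //= wE // eqxx mulr1.
by rewrite big1 ?addr0 // => j jk; rewrite wE // (negbTE jk) mulr0.
Qed.

End Charts.

(** * Construction of an adapted chart from closed forms *)

Section Integration.
Variables (R : realType) (B : body R).
Notation g := (@global_chart R B).

Definition row3 (a b c : R) : 'rV[R]_3 :=
  \row_j (if j == 0 then a else if j == 1 then b else c).

Lemma smooth_row3 U (a b c : 'rV[R]_3 -> R) : open U ->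
  smooth U a -> smooth U b -> smooth U c -> smooth U (fun x => row3 (a x) (b x) (c x)).
Proof.
move=> oU sa sb sc k; apply/Ck_rV => //; elim/ord3_case.
- by apply: eq_Ck (sa k) => // x _; rewrite mxE.
- by apply: eq_Ck (sb k) => // x _; rewrite mxE.
- by apply: eq_Ck (sc k) => // x _; rewrite mxE.
Qed.

Lemma derive_row3 (a b c : 'rV[R]_3 -> R) x v j :
  differentiable (fun x => row3 (a x) (b x) (c x)) x ->
  'D_v (fun x => row3 (a x) (b x) (c x)) x 0 j =
  row3 ('D_v a x) ('D_v b x) ('D_v c x) 0 j.
Proof.
move=> d; rewrite derive_coord //; elim/ord3_case: j; rewrite [RHS]mxE /=;
  by congr derive; apply/funext => y; rewrite mxE.
Qed.

Lemma continuous_global_chart : continuous g.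
Proof. by have [_ _ cg _] := global_chartP B => p; exact: cg. Qed.

Lemma open_range_chart : open (range g).
Proof. by apply: open_global_chart; exact: openT. Qed.

(** Read in the global chart, the new chart is [F] and its inverse is [psi], so each condition on
    coordinates reduces to one on these two maps. *)
Lemma local_diffeo_chart (W : set 'rV[R]_3) (F psi : 'rV[R]_3 -> 'rV[R]_3) :
  open W -> W `<=` range g -> smooth W F -> smooth (F @` W) psi ->
  {in W, cancel F psi} ->
  (forall W', open W' -> W' `<=` W -> open (F @` W')) ->
  local_coordinates (g @^-1` W) (F \o g).
Proof.
move=> oW Wg sF spsi FK oF.
have gW : g @` (g @^-1` W) = W.
  apply/seteqP; split=> [_ [q Wq <-] //|y Wy].
  by have [q _ qy] := Wg y Wy; exists q => //; rewrite /= qy.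
have Finj : {in g @^-1` W &, injective (F \o g)}.
  move=> q q'; rewrite !inE => Wq Wq' /(congr1 psi) /=.
  by rewrite !FK ?inE // => /global_chart_inj.
split; first (split; [|exact: Finj| |]).
- exact: (continuousP _).1 continuous_global_chart _ oW.
- move=> q Wq; apply: continuous_comp; first exact: continuous_global_chart.
  exact: smooth_continuous sF Wq.
- move=> V' oV' V'W; rewrite -image_comp; apply: oF; first exact: open_global_chart.
  by move=> _ [q /V'W Wq <-].
- rewrite gW => k; apply: eq_Ck (sF k) => // y; rewrite inE => Wy.
  by have [q _ qy] := Wg y Wy; rewrite -qy in_global_chartE //= qy.
- rewrite -image_comp gW => k; apply: eq_Ck (spsi k); first exact: oF.
  move=> z; rewrite inE => -[y Wy <-]; rewrite FK ?inE //.
  have [q _ qy] := Wg y Wy; rewrite -qy.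
  by rewrite -[F (g q)]/((F \o g) q) in_chartE //= qy.
Qed.

Lemma smooth_primitive (w : one_form B) (a : 'rV[R]_3) (r : R) :
  closed_form w -> 0 < r -> (forall y, `|y - a| <= r -> range g y) ->
  exists f : 'rV[R]_3 -> R, smooth [set y | `|y - a| < r] f /\
    forall q v, `|g q - a| < r -> 'D_v f (g q) = w q v.
Proof.
move=> cw r0 rU.
pose c j := in_chart setT g (fun q => w q (basis_vec R j) : R).
have [i j y _ _ [q _ <-]|f [sf fE]] := @partial_poincare R predT (range g) a r c r0
    open_range_chart rU (fun j => one_form_smooth w (basis_vec R j)).
  by have /eqP := cw q (basis_vec R i) (basis_vec R j); rewrite subr_eq0 => /eqP.
exists f; split=> // q v qa.
rewrite (derive_basis_sum v (smooth_differentiable sf qa)).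
rewrite [in RHS](rV3_sum v) linear_sum; apply: eq_bigr => j _.
by rewrite fE // linearZ /c in_global_chartE.
Qed.

Lemma derive_functional (b : 'cV[R]_3) (x v : 'rV[R]_3) :
  'D_v (fun y : 'rV[R]_3 => (y *m b) 0 0) x = (v *m b) 0 0.
Proof.
have dk k : differentiable (fun y : 'rV[R]_3 => y 0 k : R) x.
  exact: differentiable_coord.
have -> : (fun y : 'rV[R]_3 => (y *m b) 0 0) =
    \sum_k ((fun y : 'rV[R]_3 => y 0 k) * cst (b k 0)).
  by apply/funext => y; rewrite fct_sumE mxE.
rewrite derive_sum => [|k]; last first.
  by apply: derivableM; [exact: diff_derivable|exact: derivable_cst].
rewrite mxE; apply: eq_bigr => k _; rewrite deriveM //; last exact: diff_derivable.
by rewrite derive_cst scaler0 add0r derive_coordinate mulrC.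
Qed.

Lemma volume_basis (Om : volume_form B) q (M : 'M[R]_3) :
  Om q (row 0 M) (row 1 M) (row 2 M) =
  \det M * Om q (basis_vec R 0) (basis_vec R 1) (basis_vec R 2).
Proof. by have := volume_det Om q M 1%:M; rewrite mulmx1 !row1. Qed.

Lemma volume_basis_neq0 (Om : volume_form B) q :
  Om q (basis_vec R 0) (basis_vec R 1) (basis_vec R 2) != 0.
Proof.
have [u [v [w]]] := volume_neq0 Om q; apply: contraNneq => Om0.
pose M : 'M[R]_3 := \matrix_i (if i == 0 then u else if i == 1 then v else w).
by have := volume_basis Om q M; rewrite Om0 mulr0 !rowK /= => ->.
Qed.

(** The rows of [M] are dual to the differentials of the components of [F], which settles the two
    forms. The volume of the frame is det M times the density, that is det M * det (jac F) = 1. *)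
Lemma frame_G3C (w1 w2 : one_form B) (Om : volume_form B) q (M : 'M[R]_3)
    (F : 'rV[R]_3 -> 'rV[R]_3) : differentiable F (g q) ->
  (forall v, w1 q v = 'D_v F (g q) 0 1) -> (forall v, w2 q v = 'D_v F (g q) 0 2) ->
  \det (jac F (g q)) = Om q (basis_vec R 0) (basis_vec R 1) (basis_vec R 2) ->
  jac F (g q) *m M = 1%:M -> G3C_structure w1 w2 Om q M.
Proof.
move=> dF w1E w2E dE JM.
have MJ i k : (row i M *m jac F (g q)) 0 k = (i == k)%:R.
  by rewrite -row_mul (mulmx1C JM) !mxE.
split.
- by case: (mulmx1_unit JM).
- by rewrite !w1E !derive_jac // !MJ.
- by rewrite !w2E !derive_jac // !MJ.
- by rewrite volume_basis -dE mulrC -det_mulmx JM det1.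
Qed.

(* In the coordinates Y = (c, f1, f2) the density of the volume form is
   rho / det (jac Y); H is its antiderivative with respect to the first one. *)
Lemma straightening (U : set 'rV[R]_3) (a : 'rV[R]_3)
    (f1 f2 rho c : 'rV[R]_3 -> R) :
  open U -> U a -> smooth U f1 -> smooth U f2 -> smooth U rho -> smooth U c ->
  jac (fun y => row3 (c y) (f1 y) (f2 y)) a \in unitmx ->
  exists N H, [/\ open N, N a, N `<=` U, smooth N H &
    forall y, N y -> \det (jac (fun y => row3 (H y) (f1 y) (f2 y)) y) = rho y].
Proof.
move=> oU Ua s1 s2 srho sc Ju; set Y := (fun y => _) in Ju.
have sY : smooth U Y by exact: smooth_row3.
have [V1 [psi [[oV1 V1a V1U spsi] [YK Yu Yo]]]] := inverse_function oU sY Ua Ju.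
have oW1 := Yo V1 oV1 (@subset_refl _ V1).
have W1b : (Y @` V1) (Y a) by exists a.
pose h z := rho (psi z) * (\det (jac Y (psi z)))^-1.
have sh : smooth (Y @` V1) h.
  move=> k; have psiV z : (Y @` V1) z -> V1 (psi z).
    by move=> [y V1y <-]; rewrite YK ?inE.
  apply: CkM => //.
    by apply: (@Ck_comp _ k _ U rho psi) => // z /psiV /V1U.
  apply: (@Ck_comp _ k _ V1 (fun y => (\det (jac Y y))^-1) psi) => //.
  apply: CkV => // [y /Yu|].
    by rewrite unitmxE unitfE.
  by apply: Ck_det => // i j; apply: Ck_subset V1U _; exact: Ck_jac.
have [r r0 rW] := nbhs_norm_le (open_nbhs_nbhs (conj oW1 W1b)).
(* For the single direction 0 the closedness condition reads [i = j = 0] and is trivial. *)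
have [i j z /eqP -> /eqP -> //|H [sH HE]] := @partial_poincare R (pred1 0)
  (Y @` V1) (Y a) r (fun=> h) r0 oW1 rW (fun=> sh).
pose Wr := [set z | `|z - Y a| < r].
have oWr : open Wr by exact: open_norm_ball.
(* [H] is controlled only on a ball about [Y a], so [Y] must map the final neighbourhood into that
   ball. *)
have NV : nbhs a [set y | V1 y /\ `|Y y - Y a| < r].
  near=> y; split; first by near: y; exact: (open_nbhs_nbhs (conj oV1 V1a)).
  near: y.
  have cY := smooth_continuous sY Ua.
  have /(@cvgrPdist_lt _ _ _ (nbhs a)) /(_ r r0) := cY.
  by under eq_near do rewrite distrC.
have [s s0 sN] := nbhs_norm_le NV.
have oN : open [set y | `|y - a| < s] by exact: open_norm_ball.
have NV1 y : `|y - a| < s -> V1 y by move=> /ltW /sN[].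
have NWr y : `|y - a| < s -> Wr (Y y) by move=> /ltW /sN[].
pose K y := H (Y y).
exists [set y | `|y - a| < s], K; split=> //.
- by rewrite /= subrr normr0.
- by move=> y /NV1 /V1U.
- move=> k; apply: (@Ck_comp _ k _ Wr H Y) => //.
  by apply: Ck_subset (sY k) => y /NV1 /V1U.
move=> y Ny; have V1y := NV1 y Ny; have Wy := NWr y Ny.
(* The new map is [Phi] after [Y], and [Phi] alters only the first coordinate: its Jacobian matrix
   is triangular with diagonal entries [h], 1, 1. The factor [h] cancels det (jac Y) and leaves
   [rho]. *)
pose Phi (z : 'rV[R]_3) := row3 (H z) (z 0 1) (z 0 2).
have sPhi : smooth Wr Phi.
  by apply: smooth_row3 => // k; exact: Ck_coord.
have dY := smooth_differentiable sY (V1U _ V1y).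
have dPhi := smooth_differentiable sPhi Wy.
have -> : (fun y => row3 (K y) (f1 y) (f2 y)) = (fun y => Phi (Y y)).
  by apply/funext => z; rewrite /Phi /Y !mxE.
rewrite jac_comp // det_mulmx.
have trig : is_trig_mx (jac Phi (Y y)).
  apply/is_trig_mxP => i j; elim/ord3_case: i; elim/ord3_case: j => // _;
  by rewrite mxE derive_row3 // [LHS]mxE /= derive_coordinate basis_vecE.
have -> : \det (jac Phi (Y y)) = h (Y y).
  rewrite (det_trig trig) (bigD1 0) //= big1 => [|i].
    by rewrite mulr1 mxE derive_row3 // mxE /= HE.
  elim/ord3_case: i => // _; rewrite mxE derive_row3 // mxE /=;
    by rewrite derive_coordinate basis_vecE.
rewrite /h YK ?inE //.
have := Yu y V1y; rewrite unitmxE unitfE => d0.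
by rewrite mulrCA divff // mulr1.
Unshelve. all: by end_near.
Qed.

Lemma closed_integrable (w1 w2 : one_form B) (Om : volume_form B) :
  (forall p, lin_indep_at w1 w2 p) -> closed_form w1 -> closed_form w2 ->
  integrable_structure (G3C_structure w1 w2 Om).
Proof.
move=> w12 cw1 cw2 p.
have gp : range g (g p) by exists p.
have [r r0 rU] := nbhs_norm_le (open_nbhs_nbhs (conj open_range_chart gp)).
pose U := [set y | `|y - g p| < r].
have oU : open U by exact: open_norm_ball.
have Up : U (g p) by rewrite /U /= subrr normr0.
have Ug : U `<=` range g by move=> y /ltW /rU.
have [f1 [s1 f1E]] := smooth_primitive cw1 r0 rU.
have [f2 [s2 f2E]] := smooth_primitive cw2 r0 rU.
pose rho := in_chart setT g
  (fun q => Om q (basis_vec R 0) (basis_vec R 1) (basis_vec R 2) : R).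
have rhoE q : rho (g q) = Om q (basis_vec R 0) (basis_vec R 1) (basis_vec R 2).
  by rewrite /rho in_global_chartE.
have srho : smooth U rho.
  by move=> k; apply: Ck_subset Ug _; exact: volume_smooth.
have [E [Eu [e11 e10 e12] [e22 e20 e21] _]] := G3C_structure_nonempty Om (w12 p).
(* With this c, the coordinate frame of (c, f1, f2) at p is E. *)
pose c (y : 'rV[R]_3) := (y *m col 0 (invmx E)) 0 0.
have sc : smooth U c.
  move=> k; have : Ck k U (fun y : 'rV[R]_3 => \sum_i y 0 i * col 0 (invmx E) i 0).
    by apply: Ck_sum => // i _; apply: CkM => //; [exact: Ck_coord|exact: Ck_cst].
  by apply: eq_Ck => // y _; rewrite /c mxE.
have rho0 y : U y -> rho y != 0.
  by move=> /Ug[q _ <-]; rewrite rhoE volume_basis_neq0.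
have sY := smooth_row3 oU sc s1 s2.
have dY := smooth_differentiable sY Up.
(* Row [i] of the product lists the derivatives of [c], [f1], [f2] along the [i]-th vector of [E].
   The last two are the values of [w1] and [w2], normalised because [E] belongs to the structure at
   [p]. *)
have EJ : E *m jac (fun y => row3 (c y) (f1 y) (f2 y)) (g p) = 1%:M.
  have DE i j : (E *m jac (fun y => row3 (c y) (f1 y) (f2 y)) (g p)) i j =
      row3 ('D_(row i E) c (g p)) ('D_(row i E) f1 (g p)) ('D_(row i E) f2 (g p)) 0 j.
    by rewrite -derive_row3 // derive_jac // -row_mul [RHS]mxE.
  have cE i : 'D_(row i E) c (g p) = (i == 0)%:R.
    by rewrite derive_functional colE mulmxA -row_mul mulmxV // -colE !mxE.
  apply/matrixP => i j; rewrite DE cE f1E // f2E // [RHS]mxE.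
  by elim/ord3_case: i; elim/ord3_case: j; rewrite [LHS]mxE.
have Yu : jac (fun y => row3 (c y) (f1 y) (f2 y)) (g p) \in unitmx.
  by case: (mulmx1_unit EJ).
have [N [H [oN Np NU sH HE]]] := straightening oU Up s1 s2 srho sc Yu.
pose F y := row3 (H y) (f1 y) (f2 y).
have sF : smooth N F.
  by apply: smooth_row3 => // k; [apply: Ck_subset (s1 k)|apply: Ck_subset (s2 k)].
(* Invertibility comes directly from the determinant equation, since the density [rho] does not
   vanish. *)
have Fu : jac F (g p) \in unitmx.
  by rewrite unitmxE unitfE HE // rho0.
have [W [psi [[oW Wp WN spsi] [FK _ oF]]]] := inverse_function oN sF Np Fu.
have sFW : smooth W F by move=> k; apply: Ck_subset (sF k).
have lx := local_diffeo_chart oW (subset_trans WN (subset_trans NU Ug)) sFW spsi FK oF.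
exists (g @^-1` W), (F \o g); split; [exact: Wp|exact: lx|move=> q Wq].
have [oV dphi jE] := chart_jac lx Wq.
have Nq := WN _ Wq.
have dF := smooth_differentiable sF Nq.
apply: (@frame_G3C _ _ _ _ _ F dF).
- by move=> v; rewrite (derive_row3 v 1 dF) mxE /= f1E //; exact: NU.
- by move=> v; rewrite (derive_row3 v 2 dF) mxE /= f2E //; exact: NU.
- by rewrite (HE _ Nq) rhoE.
have gWq : (g @` (g @^-1` W)) (g q) by exists q.
(* [F] and the representative of the chart agree only on the image of the domain; that set is open,
   so their derivatives agree there. *)
suff -> : jac F (g q) = jac (in_chart (g @^-1` W) g (F \o g)) (g q) by exact: jE.
apply/row_matrixP => i; rewrite !rowK; apply: (eq_derive_open _ oV _ gWq) => y.
by rewrite inE => -[q' Wq' <-]; rewrite in_global_chartE.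
Qed.

End Integration.

Theorem proposition6p16 (R : realType) (B : body R)
    (w1 w2 : one_form B) (Om : volume_form B)
    (w_indep : forall p : B, lin_indep_at w1 w2 p) :
  integrable_structure (G3C_structure w1 w2 Om) <->
  closed_form w1 /\ closed_form w2.
Proof.
split=> [|[cw1 cw2]]; first exact: integrable_closed.
exact: closed_integrable.
Qed.
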